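(* Let $\lambda,\mu>0$, $k\ge1$ an integer and $\nu\in(0,1)$. Let $p_0^\nu(t)=\mathbb{P}(Q^\nu(t)=(0,0)\mid Q^\nu(0)=(0,0))$ be the $0$ state probability of a $\nu$-fractional $M/E_k/1$ queue $Q^\nu(t)$ and let $\pi_0^\nu(v)$ be its Laplace transform. Then $$p_0^\nu(t)=\sum_{m=1}^{+\infty}\sum_{r=0}^{+\infty}C^0_{m,r}\,t^{\gamma^0_{m,r}-1}E_{\nu,\gamma^0_{m,r}}^{\delta^0_{m,r}}(-(\lambda+k\mu)t^\nu)$$ and $$\pi_0^\nu(v)=\sum_{m=1}^{+\infty}\sum_{r=0}^{+\infty}C^0_{m,r}\frac{v^{\nu\delta^0_{m,r}-\gamma^0_{m,r}}}{(\lambda+k\mu+v^\nu)^{\delta^0_{m,r}}},\qquad v>0,$$ where $$C^0_{m,r}=\frac{m}{m+r(k+1)}\binom{m+r(k+1)}{m+rk}\lambda^r(k\mu)^{m+rk-1},\qquad \delta^0_{m,r}=m+r(k+1),\qquad \gamma^0_{m,r}=\nu(\delta^0_{m,r}-1)+1.$$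
   Context: Classical queue: let $\mathcal{S}^*=\{(n,s): n\ge 1,\ 1\le s\le k\}$ ($n,s$ integers) and $\mathcal{S}=\mathcal{S}^*\cup\{(0,0)\}$. The state-phase process $Q(t)=(N(t),S(t))$ of the classical $M/E_k/1$ queue ($N$ = number of customers in the system, $S$ = phase of the customer currently being served, $S=0$ if $N=0$) is the continuous-time Markov chain on $\mathcal{S}$ with transition rates: $(0,0)\to(1,k)$ at rate $\lambda$; $(n,s)\to(n+1,s)$ at rate $\lambda$ for $(n,s)\in\mathcal{S}^*$; $(n,s)\to(n,s-1)$ at rate $k\mu$ for $s\ge2$; $(n,1)\to(n-1,k)$ at rate $k\mu$ for $n\ge2$; $(1,1)\to(0,0)$ at rate $k\mu$. Fractional queue: let $\{\sigma_\nu(t)\}_{t\ge0}$ be a $\nu$-stable subordinator independent of $Q$, with $\mathbb{E}[e^{-v\sigma_\nu(t)}]=e^{-tv^\nu}$ for $v>0$, and let $L_\nu(t)=\inf\{s\ge0:\sigma_\nu(s)>t\}$. The $\nu$-fractional $M/E_k/1$ queue has state-phase process $Q^\nu(t):=Q(L_\nu(t))$. Three-parameter Mittag-Leffler function: $E_{\nu,\gamma}^{\delta}(z)=\sum_{j=0}^{+\infty}\frac{\Gamma(\delta+j)\,z^j}{j!\,\Gamma(\delta)\,\Gamma(\nu j+\gamma)}$. *)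

(* Defs.v *)
From HB Require Import structures.
From mathcomp Require Import all_boot all_order all_algebra.
From mathcomp Require Import all_classical all_reals all_analysis.

Set Implicit Arguments.
Unset Strict Implicit.
Unset Printing Implicit Defensive.

Import Order.TTheory GRing.Theory Num.Theory.
Import numFieldNormedType.Exports.

Local Open Scope classical_set_scope.
Local Open Scope ring_scope.

Section special_functions.
Variable R : realType.

(* Meaningful for x > 0 only, where the integral is finite. *)
Definition Gamma (x : R) : R :=
  \int[lebesgue_measure]_(t in `]0%R, +oo[) (t `^ (x - 1) * expR (- t)).

Definition mittag_leffler (nu gamma delta z : R) : R :=
  limn (series (fun j : nat =>
    Gamma (delta + j%:R) * z ^+ j
      / ((j`!)%:R * Gamma delta * Gamma (nu * j%:R + gamma)))).

Definition laplace (f : R -> R) (v : R) : R :=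
  \int[lebesgue_measure]_(t in `[0%R, +oo[) (expR (- (v * t)) * f t).

(* l = sum_(m >= 1) sum_(r >= 0) a m r, all the series involved converging. *)
Definition double_series_sum (a : nat -> nat -> R) (l : R) : Prop :=
  (forall m, (1 <= m)%N -> cvgn (series (a m))) /\
  (\sum_(1 <= m < M) limn (series (a m))) @[M --> \oo] --> l.

End special_functions.

Section markov_chains.
Variables (R : realType) (E : countType).

Definition is_transition_function (p : R -> E -> E -> R) : Prop :=
  [/\ forall (t : R) i j, 0 <= t -> 0 <= p t i j,
      forall (t : R) i, 0 <= t -> (\esum_(j in [set: E]) (p t i j)%:E = 1)%E,
      forall i j, p 0 i j = (i == j)%:R &
      forall (s t : R) i j, 0 <= s -> 0 <= t ->
        ((p (s + t)%R i j)%:E = \esum_(l in [set: E]) (p s i l * p t l j)%:E)%E].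

(* q x y is read for x <> y only; the total exit rate from x is the sum of
   the q x y over y <> x. *)
Definition has_rates (p : R -> E -> E -> R) (q : E -> E -> R) : Prop :=
  (forall i j, i != j -> (p h i j / h) @[h --> 0^'+] --> q i j) /\
  (forall i, ((1 - p h i i) / h)%:E @[h --> 0^'+]
     --> (\esum_(j in [set j | j != i]) (q i j)%:E)%E).

Variables (d : measure_display) (T : measurableType d) (P : probability T R).

Definition markov_property (p : R -> E -> E -> R) (X : R -> T -> E) : Prop :=
  forall (past : seq (R * E)) (s t : R) (i j : E),
    (forall x, x \in past -> 0 <= x.1 <= s) -> 0 <= s -> s <= t ->
    let H := [set w | forall x, x \in past -> X x.1 w = x.2] in
    (P (H `&` [set w | X s w = i] `&` [set w | X t w = j]) =
     P (H `&` [set w | X s w = i]) * (p (t - s)%R i j)%:E)%E.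

(* Time-homogeneous chain with rates q, in its right-continuous version (for
   the discrete topology on E) and with an arbitrary initial distribution. *)
Definition is_ctmc (q : E -> E -> R) (X : R -> T -> E) : Prop :=
  [/\ forall (t : R) i, 0 <= t -> measurable [set w | X t w = i],
      forall w (t : R), 0 <= t -> \forall s \near t^'+, X s w = X t w &
      exists p : R -> E -> E -> R,
        [/\ is_transition_function p, has_rates p q & markov_property p X]].

End markov_chains.

Section queue.
Variable R : realType.

Definition in_states (k : nat) (x : nat * nat) : bool :=
  (x == (0, 0)%N) || [&& 1 <= x.1, 1 <= x.2 & x.2 <= k]%N.

Definition state (k : nat) := {x : nat * nat | in_states k x}.

Definition empty_state (k : nat) : state k := exist _ (0, 0)%N isT.

Definition pair_rate (lambda mu : R) (k : nat) (x y : nat * nat) : R :=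
  let: (n, s) := x in
  if x == (0, 0)%N then (if y == (1, k)%N then lambda else 0)
  else if y == (n.+1, s) then lambda
  else if [&& 2 <= s & y == (n, s.-1)]%N then k%:R * mu
  else if [&& s == 1, 2 <= n & y == (n.-1, k)]%N then k%:R * mu
  else if (x == (1, 1)%N) && (y == (0, 0)%N) then k%:R * mu
  else 0.

Definition MEk1_rate (lambda mu : R) (k : nat) (x y : state k) : R :=
  pair_rate lambda mu k (val x) (val y).

End queue.

Section fractional_queue.
Variables (R : realType) (d : measure_display) (T : measurableType d).
Variable P : probability T R.

Definition is_stable_subordinator (nu : R) (sigma : R -> T -> R) : Prop :=
  [/\ forall t : R, 0 <= t -> measurable_fun [set: T] (sigma t),
      P [set w | sigma 0 w = 0] = 1%E,
      (forall w (s t : R), 0 <= s -> s <= t -> sigma s w <= sigma t w) /\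
      (forall w (t : R), 0 <= t -> sigma s w @[s --> t^'+] --> sigma t w),
      (forall (n : nat) (t : nat -> R) (B : nat -> set R),
        0 <= t 0%N -> {homo t : i j / (i <= j)%N >-> i <= j} ->
        (forall i, measurable (B i)) ->
        let A i := [set w | B i (sigma (t i.+1) w - sigma (t i) w)] in
        P [set w | forall i, (i < n)%N -> A i w] = (\prod_(i < n) P (A i))%E) /\
      (forall (s t : R) (B : set R), 0 <= s -> s <= t -> measurable B ->
        P [set w | B (sigma t w - sigma s w)] = P [set w | B (sigma (t - s) w)]) &
      forall t v : R, 0 <= t -> 0 < v ->
        ('E_P[fun w => expR (- (v * sigma t w))] = (expR (- (t * v `^ nu)))%:E)%E].

(* The set is empty with probability 0 only; inf is 0 there. *)
Definition inverse_process (sigma : R -> T -> R) (t : R) (w : T) : R :=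
  inf [set s | 0 <= s /\ t < sigma s w].

Definition independent_sigma_algebras (F G : set (set T)) : Prop :=
  forall A B, F A -> G B -> P (A `&` B) = (P A * P B)%E.

Definition discrete_history (E : Type) (X : R -> T -> E) : set (set T) :=
  <<s [set A | exists (t : R) i, 0 <= t /\ A = [set w | X t w = i]] >>.

Definition real_history (X : R -> T -> R) : set (set T) :=
  <<s [set A | exists (t : R) (B : set R), [/\ 0 <= t, measurable B & A = X t @^-1` B]] >>.

Definition cond_prob (A B : set T) : R := fine (P (A `&` B)) / fine (P B).

Definition is_fractional_MEk1 (lambda mu nu : R) (k : nat)
    (Qnu : R -> T -> state k) : Prop :=
  exists (Q : R -> T -> state k) (sigma : R -> T -> R),
    [/\ is_ctmc P (@MEk1_rate R lambda mu k) Q,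
        is_stable_subordinator nu sigma,
        independent_sigma_algebras (discrete_history Q) (real_history sigma) &
        forall (t : R) (w : T), 0 <= t ->
          Qnu t w = Q (inverse_process sigma t w) w].

Definition p0 (k : nat) (Qnu : R -> T -> state k) (t : R) : R :=
  cond_prob [set w | Qnu t w = empty_state k] [set w | Qnu 0 w = empty_state k].

End fractional_queue.

Section coefficients.
Variables (R : realType) (lambda mu nu : R) (k : nat).

Definition delta0 (m r : nat) : nat := (m + r * k.+1)%N.

Definition gamma0 (m r : nat) : R := nu * ((delta0 m r)%:R - 1) + 1.

Definition C0 (m r : nat) : R :=
  m%:R / (m + r * k.+1)%:R * ('C(m + r * k.+1, m + r * k))%:R
    * lambda ^+ r * (k%:R * mu) ^+ (m + r * k - 1).

End coefficients.

(* Main.v *)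
(* Let p00 be the probability that the classical queue, started empty, is
   empty, and let a = lambda + k mu.  The number of service phases still to be
   completed is a walk with steps +k and -1, and the bounded solution of the
   resolvent equations is unique; hence the Laplace transform of p00 at v is
   sum_(m >= 1) z^m / (k mu), where z < 1 is the weight of the first passage
   from 1 to 0 for step weights lambda / (a + v) and k mu / (a + v).  Ballot
   numbers expand z^m, which gives sum_(m, r) C0 / (a + v)^delta, and Laplace
   inversion gives p00(s) = sum_(m, r) C0 s^(delta-1) / (delta-1)! e^(- a s).
   With L the inverse subordinator, independence and right-continuity yield
   p0(t) = E p00(L_t).  At an independent exponential time of rate v, L is
   exponential of rate v^nu: this is the formula for the transform of p0, and
   by inversion E L_t^n = n! t^(nu n) / Gamma(nu n + 1), so that
   E (L_t^n e^(- a L_t)) / n! is the Mittag-Leffler term with n = delta - 1. *)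

Require Import Defs.
From HB Require Import structures.
From mathcomp Require Import all_boot all_order all_algebra.
From mathcomp Require Import all_classical all_reals all_analysis.
From mathcomp Require Import measurable_realfun.
From mathcomp Require Import zify ring lra.
Set Implicit Arguments.
Unset Strict Implicit.
Unset Printing Implicit Defensive.

Import Order.TTheory GRing.Theory Num.Theory.
Import numFieldNormedType.Exports.
Local Open Scope classical_set_scope.
Local Open Scope ring_scope.

(** * First passages of a batch walk *)

(** Both Laplace inversions rest on one asymmetric statement: a function continuous on t > 0 and a
    nondecreasing one agree on t > 0 as soon as their transforms agree at all large integers. The
    continuous side is explicit, or is p00; the monotone side is a moment of L_t, or a power series
    with nonnegative coefficients. So no regularity of that side has to be proved, only its
    finiteness. This is why p00(s) is first multiplied by e^(a s): without that factor the series is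
    not monotone. Injectivity itself comes from the kernels exp(- e^(n (x - t))), which are power
    series in e^(- n t) and tend to the indicator of t > x. Series with nonnegative terms are summed
    in the extended reals, where sums and integrals commute freely. The Mittag-Leffler series
    alternates, so its expansion needs domination, hence exponential moments of L_t; these also come
    from an exponential time. The process Q is known to be measurable at fixed times only, so Q at
    time L_t is reached through discretized times. The rates are derivatives at time 0 only, so the
    backward equation is derived with an error bound uniform in time. *)

Definition ballot {R : realType} (k m r : nat) : R :=
  m%:R / (m + r * k.+1)%:R * 'C(m + r * k.+1, r)%:R.

(** Choosing the positions of the r upward steps instead of the m + r k downward ones shows the
    ballot number: for m > 0, it counts the walks from m that first reach 0 at their last step, with
    exactly r steps +k. *)
Lemma C0_ballot {R : realType} (lambda mu : R) k m r :
  C0 lambda mu k m r = ballot k m r * lambda ^+ r * (k%:R * mu) ^+ (m + r * k - 1).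
Proof.
rewrite /C0 /ballot; congr (_ * _%:R * _ * _).
by rewrite -bin_sub ?leq_add2l ?leq_mul2l ?leqnSn ?orbT// mulnS addnCA addnK.
Qed.

Lemma ballot_ge0 {R : realType} k m r : 0 <= ballot k m r :> R.
Proof. by rewrite /ballot mulr_ge0// divr_ge0. Qed.

Lemma ballotr0 {R : realType} k m : (0 < m)%N -> ballot k m 0 = 1 :> R.
Proof.
by move=> m0; rewrite /ballot mul0n addn0 bin0 mulr1 divff// pnatr_eq0 -lt0n.
Qed.

(** This value is why [passage_sum] treats m = 0 apart: the series would vanish there, whereas a
    walk started at 0 has already arrived and has total weight 1. *)
Lemma ballot0r {R : realType} k r : ballot k 0 r = 0 :> R.
Proof. by rewrite /ballot mul0r mul0r. Qed.

(** Absorption, N C(N-1, r) = (r+1) C(N, r+1), trades the denominator N, which depends on m, for r +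
    1. *)
Lemma ballotrS {R : realType} k m r :
  ballot k m r.+1 = m%:R / r.+1%:R * 'C((m + r.+1 * k.+1).-1, r)%:R :> R.
Proof.
rewrite /ballot; set N := (m + r.+1 * k.+1)%N.
have N0 : N%:R != 0 :> R by rewrite pnatr_eq0 /N mulSn addnCA addSn.
have r0 : r.+1%:R != 0 :> R by rewrite pnatr_eq0.
have := congr1 (fun n => n%:R : R) (mul_bin_diag N r); rewrite /= !natrM => E.
apply: (mulfI N0); apply: (mulfI r0).
transitivity (m%:R * (r.+1%:R * 'C(N, r.+1)%:R) : R); first by field.
by rewrite -E; field; rewrite addrC natr1.
Qed.

(** First-step decomposition: from m + 1 the walk goes down to m and keeps its r + 1 upward steps,
    or goes up to m + 1 + k and has r of them left. *)
Lemma ballot_rec {R : realType} k m r :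
  ballot k m.+1 r.+1 = ballot k m r.+1 + ballot k (m.+1 + k) r :> R.
Proof.
pose n := (m + r * k.+1 + k)%N.
rewrite !ballotrS /ballot.
have -> : ((m.+1 + r.+1 * k.+1).-1 = n.+1)%N by rewrite /n mulSn; lia.
have -> : ((m + r.+1 * k.+1).-1 = n)%N by rewrite /n mulSn; lia.
have -> : (m.+1 + k + r * k.+1 = n.+1)%N by rewrite /n; lia.
have N0 : n.+1%:R != 0 :> R by rewrite pnatr_eq0.
have r0 : r.+1%:R != 0 :> R by rewrite pnatr_eq0.
have rn : (r <= n.+1)%N by rewrite /n mulnS; lia.
have := congr1 (fun n => n%:R : R) (mul_bin_down n.+1 r).
rewrite /= !natrM natrB// => E.
apply: (mulfI N0); apply: (mulfI r0).
transitivity (m.+1%:R * n.+1%:R * 'C(n.+1, r)%:R : R); first by field; rewrite addrC natr1.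
transitivity (m%:R * (n.+1%:R * 'C(n, r)%:R)
   + r.+1%:R * (m.+1 + k)%:R * 'C(n.+1, r)%:R : R); last first.
  by field; rewrite ![1 + _]addrC !natr1 N0 r0.
rewrite E mulrA -mulrDl; congr (_ * _).
by rewrite -natrB// -!natrM -natrD; congr _%:R; rewrite /n; nia.
Qed.

Section first_passage.
Context {R : realType}.
Variables (k : nat) (A B : R).
Hypotheses (A0 : 0 <= A) (B0 : 0 <= B) (AB : A + B < 1).

(* Distribution of the first passage time to 0, from m, of the walk with steps
   +k and -1 of weights A and B, truncated to at most n upward steps. *)
Definition passage_sum (m n : nat) : R :=
  if m is 0 then 1
  else series (fun r => ballot k m r * A ^+ r * B ^+ (m + r * k)) n.

Definition passage (m : nat) : R := limn (passage_sum m).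

(** An upward first step uses up one unit of the truncation index, a downward one does not; hence
    [n] and [n.+1] on the right. *)
Lemma passage_sum_rec m n :
  passage_sum m.+1 n.+1 = B * passage_sum m n.+1 + A * passage_sum (m.+1 + k) n.
Proof.
rewrite /= [LHS]big_nat_recl//= ballotr0// mul0n addn0 expr0 2!mul1r.
under eq_bigr do rewrite ballot_rec -mulrA mulrDl.
rewrite big_split/= addrA; congr (_ + _); last first.
  rewrite /series/= mulr_sumr; apply: eq_bigr => r _.
  by rewrite (exprS A) (_ : m.+1 + r.+1 * k = m.+1 + k + r * k)%N ?mulSn ?addnA//; ring.
case: m => [|m].
  by rewrite expr1 big1 ?addr0 ?mulr1// => r _; rewrite ballot0r mul0r.
rewrite /passage_sum /series/= big_nat_recl//= ballotr0// mul0n addn0 expr0 2!mul1r.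
rewrite mulrDr (exprS B) mulr_sumr; congr (_ + _); apply: eq_bigr => r _.
by rewrite addSn (exprS B); ring.
Qed.

Lemma passage_sum_ge0 m n : 0 <= passage_sum m n.
Proof.
case: m => [|m]; first exact: ler01.
by apply: sumr_ge0 => r _; rewrite !mulr_ge0 ?exprn_ge0 ?ballot_ge0.
Qed.

(** The recursion has weights of sum below 1. An upward step lowers [n] whatever becomes of the
    position, and a downward step lowers [m] at fixed [n], hence the nested inductions. *)
Lemma passage_sum_le1 m n : passage_sum m n <= 1.
Proof.
elim: n m => [|n IHn] m; first by case: m => // m; rewrite /passage_sum /series/= big_geq.
elim: m => [|m IHm]; first exact: lexx.
rewrite passage_sum_rec.
have := ler_wpM2l B0 IHm; have := ler_wpM2l A0 (IHn (m.+1 + k)%N).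
by move: AB; lra.
Qed.

Lemma passage_sum_nd m : nondecreasing_seq (passage_sum m).
Proof.
case: m => [|m]; first by move=> *; exact: lexx.
by apply: nondecreasing_series => r _ _; rewrite !mulr_ge0 ?exprn_ge0 ?ballot_ge0.
Qed.

Lemma is_cvg_passage_sum m : cvgn (passage_sum m).
Proof.
apply: nondecreasing_is_cvgn; first exact: passage_sum_nd.
by exists 1 => _ [n _ <-]; exact: passage_sum_le1.
Qed.

Lemma passage_ge0 m : 0 <= passage m.
Proof. by apply: limr_ge; [exact: is_cvg_passage_sum|apply: nearW => n; exact: passage_sum_ge0]. Qed.

Lemma passage_le1 m : passage m <= 1.
Proof. by apply: limr_le; [exact: is_cvg_passage_sum|apply: nearW => n; exact: passage_sum_le1]. Qed.

Lemma passage0 : passage 0 = 1.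
Proof. exact: lim_cst. Qed.

Lemma passage_rec m : passage m.+1 = B * passage m + A * passage (m.+1 + k).
Proof.
apply/cvg_lim => //; rewrite -cvg_shiftS/=.
rewrite (eq_cvg _ _ (passage_sum_rec m)).
apply: cvgD; apply: cvgMl_tmp; last exact: is_cvg_passage_sum.
by have := @is_cvg_passage_sum m; rewrite -[X in X -> _]cvg_shiftS.
Qed.

End first_passage.

(* Iterating the contraction from the a priori bound M. *)
Lemma bounded_contraction_eq0 {R : realType} (I : Type) (f : I -> R) (M c : R) :
  0 <= c -> c < 1 -> (forall i, `|f i| <= M) ->
  (forall K, (forall i, `|f i| <= K) -> forall i, `|f i| <= c * K) ->
  forall i, f i = 0.
Proof.
move=> c0 c1 fM step i; apply/eqP; rewrite -normr_le0.
have bound n : `|f i| <= c ^+ n * M.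
  elim: n i => [|n IHn] i; first by rewrite expr0 mul1r.
  by rewrite exprS -mulrA; exact: step.
have : c ^+ n * M @[n --> \oo] --> 0 * M.
  by apply: cvgM (cvg_expr _) (cvg_cst _); rewrite ger0_norm.
by rewrite mul0r => h; apply: (cvgr_to_ge h); exact: nearW.
Qed.

Section first_passage_geometric.
Context {R : realType}.
Variables (k : nat) (A B : R).
Hypotheses (A0 : 0 <= A) (B0 : 0 <= B) (AB : A + B < 1).
Local Notation passage := (passage k A B).

(* Both sides, as functions of m, are bounded solutions of the same recursion
   with the same value at m = 0. *)
Lemma passageS m : passage m.+1 = passage 1 * passage m.
Proof.
apply/eqP; rewrite -subr_eq0; apply/eqP.
pose f m := passage m.+1 - passage 1 * passage m.
have p0 := passage_ge0 k A0 B0 AB; have p1 := passage_le1 k A0 B0 AB.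
apply: (@bounded_contraction_eq0 R _ f 1 (A + B)); rewrite ?addr_ge0//.
  move=> {}m; rewrite /f ler_norml.
  have := ler_pM (p0 1%N) (p0 m) (p1 1%N) (p1 m); have := mulr_ge0 (p0 1%N) (p0 m).
  by have := p0 m.+1; have := p1 m.+1; lra.
move=> K fK [|{}m].
  by rewrite /f passage0 mulr1 subrr normr0 mulr_ge0 ?addr_ge0// (le_trans _ (fK 0%N)).
have -> : f m.+1 = B * f m + A * f (m.+1 + k)%N.
  by rewrite /f [passage m.+2]passage_rec// [passage m.+1]passage_rec// !addSn; ring.
rewrite mulrDl addrC; apply: (le_trans (ler_normD _ _)).
by rewrite !normrM ger0_norm// (ger0_norm B0) lerD// ler_wpM2l.
Qed.

Lemma passageE m : passage m = passage 1 ^+ m.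
Proof. by elim: m => [|m IHm]; [rewrite passage0 expr0|rewrite passageS IHm exprS]. Qed.

Lemma passage1_lt1 : passage 1 < 1.
Proof.
apply: le_lt_trans AB; rewrite passage_rec// passage0 mulr1 addrC lerD2r.
by rewrite ler_piMr// passage_le1.
Qed.

End first_passage_geometric.

(** * Injectivity of the Laplace transform *)

Lemma measurable_expR_affine {R : realType} (a x : R) :
  measurable_fun setT (fun t : R => expR (a * (x - t))).
Proof.
apply: measurableT_comp => //; apply: measurable_funM => //.
exact: measurable_funB.
Qed.

(* Pointwise limit of the kernel (Gumbel distribution functions). *)
Lemma cvg_expRNexpR {R : realType} (d : R) : d != 0 ->
  expR (- expR (n.+1%:R * d)) @[n --> \oo] --> ((d < 0)%R%:R : R).
Proof.
rewrite neq_lt => /orP[d0|d0]; last first.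
  rewrite ltNge (ltW d0)/=.
  apply: (@squeeze_cvgr _ _ _ _ (cst 0) (fun n => expR (- d) ^+ n)).
  - apply: nearW => n; rewrite expR_ge0/= -expRM_natl ler_expR mulrN lerN2.
    apply: le_trans (expR_ge1Dx _); rewrite -natr1 mulrDl mul1r.
    by rewrite addrCA lerDl addr_ge0 ?ltW.
  - exact: cvg_cst.
  - by apply: cvg_expr; rewrite ger0_norm ?expR_ge0// -expR0 ltr_expR oppr_lt0.
rewrite d0/= -[1%:R](@expR0 R) -oppr0.
apply: continuous_cvg; first exact: continuous_expR.
apply: cvgN; rewrite (_ : (fun _ => _) = (fun n => expR d ^+ n.+1)); last first.
  by apply/funext => n; rewrite expRM_natl.
rewrite (cvg_shiftS (fun n => expR d ^+ n)).
by apply: cvg_expr; rewrite ger0_norm ?expR_ge0// -expR0 ltr_expR.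
Qed.

Section laplace_uniqueness.
Context {R : realType}.
Local Notation mu := (@lebesgue_measure R).
Implicit Types (D : R -> R) (x t : R) (n N : nat).

Lemma series_exp_coeff_le x N : 0 <= x -> series (exp_coeff x) N <= expR x.
Proof.
move=> x0; apply: nondecreasing_cvgn_le; last exact: is_cvg_series_exp_coeff.
by apply: nondecreasing_series => n _ _; exact: exp_coeff_ge0.
Qed.

Lemma normr_series_exp_coeff_le x N : `|series (exp_coeff x) N| <= expR `|x|.
Proof.
apply: le_trans (series_exp_coeff_le N (normr_ge0 x)).
rewrite -normed_series_exp_coeff; apply: le_trans (ler_norm_sum _ _ _) _.
exact: lexx.
Qed.

Variable D : R -> R.
Hypothesis intD : mu.-integrable `[0%R, +oo[ (fun t => (expR (- t) * D t)%:E).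
Hypothesis D0 : forall n, (0 < n)%N ->
  (\int[mu]_(t in `[0%R, +oo[) (expR (- (n%:R * t)) * D t)%:E = 0)%E.

Let g t := expR (- t) * D t.

Let intM (K : R -> R) (M : R) : measurable_fun setT K ->
  (forall t, 0 <= t -> `|K t| <= M) ->
  mu.-integrable `[0%R, +oo[ (fun t => (K t * g t)%:E).
Proof.
move=> mK KM; apply: (le_integrable _ _ _ (integrableZl _ M intD)) => //.
- apply/measurable_EFinP/measurable_funM; first exact: measurable_funTS.
  by apply/measurable_EFinP; exact: measurable_int intD.
- move=> t /=; rewrite in_itv/= andbT => t0; rewrite lee_fin !normrM.
  by rewrite ler_wpM2r// (le_trans (KM _ t0))// ler_norm.
Qed.

Let expE n x t j : exp_coeff (- expR (n%:R * (x - t))) j * g t =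
  (- expR (n%:R * x)) ^+ j / j`!%:R * (expR (- ((n * j).+1%:R * t)) * D t).
Proof.
rewrite /g /exp_coeff/=.
have -> : expR (n%:R * (x - t)) = expR (n%:R * x) * expR (- (n%:R * t)).
  by rewrite -expRD -mulrBr.
have -> : expR (- ((n * j).+1%:R * t)) = expR (- (n%:R * t)) ^+ j * expR (- t).
  by rewrite -expRM_natl -expRD -natr1 natrM; congr expR; ring.
by rewrite -mulNr exprMn; ring.
Qed.

(* Since exp(- e^(n(x - t))) is a convergent power series in e^(- n t), it is
   orthogonal to D; as n grows it approaches the indicator function of t > x. *)
Let gumbel_orthogonal n x : (0 < n)%N ->
  (\int[mu]_(t in `[0%R, +oo[) (expR (- expR (n%:R * (x - t))) * g t)%:E = 0)%E.
Proof.
move=> n0.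
pose K N t := series (exp_coeff (- expR (n%:R * (x - t)))) N.
have mK N : measurable_fun setT (K N).
  apply: measurable_sum => j; apply: measurable_funM => //; apply: measurable_funX.
  by apply: measurableT_comp => //; exact: measurable_expR_affine.
pose M := expR (expR (n%:R * x)).
have KM N t : 0 <= t -> `|K N t| <= M.
  move=> t0; apply: le_trans (normr_series_exp_coeff_le _ _) _.
  by rewrite normrN ger0_norm ?expR_ge0// !ler_expR ler_wpM2l// gerBl.
have intK N : (\int[mu]_(t in `[0%R, +oo[) (K N t * g t)%:E = 0)%E.
  transitivity (\int[mu]_(t in `[0%R, +oo[) (\sum_(0 <= j < N)
      (((- expR (n%:R * x)) ^+ j / j`!%:R)%:E *
        (expR (- ((n * j).+1%:R * t)) * D t)%:E))%E)%E.
    apply: eq_integral => t _; rewrite /K /series/= mulr_suml -sumEFin.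
    by apply: eq_bigr => j _; rewrite expE.
  have intj j : mu.-integrable `[0%R, +oo[
      (fun t => (expR (- ((n * j).+1%:R * t)) * D t)%:E).
    apply: (@eq_integrable _ _ _ mu _ _ (fun t => (expR (- ((n * j)%:R * t)) * g t)%:E)) => //.
      by move=> t _; rewrite /g mulrA -expRD -natr1 mulrDl mul1r opprD.
    apply: (@intM _ 1).
      by under eq_fun do rewrite -mulrN -[- _]add0r; exact: measurable_expR_affine.
    move=> t t0; rewrite ger0_norm ?expR_ge0// -expR0 ler_expR.
    by rewrite oppr_le0 mulr_ge0.
  rewrite integral_sum//; last by move=> j; exact: integrableZl.
  by rewrite big1// => j _; rewrite integralZl// D0// mule0.
have /cvg_lim <- // : (\int[mu]_(t in `[0%R, +oo[) (K N t * g t)%:E)%E @[N --> \oo] -->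
    (\int[mu]_(t in `[0%R, +oo[) (expR (- expR (n%:R * (x - t))) * g t)%:E)%E.
  apply: (@dominated_cvg _ _ _ mu _ _ _ _ (fun t => (M%:E * `|(g t)%:E|)%E)) => //.
  - move=> N; apply/measurable_EFinP/measurable_funM.
      by apply: measurable_funTS; exact: mK.
    by apply/measurable_EFinP; exact: measurable_int intD.
  - move=> t _; apply/cvg_EFin; first exact: nearW.
    by apply: cvgM (cvg_cst _); exact: is_cvg_series_exp_coeff.
  - by apply: integrableZl => //; exact: integrable_abse.
  - move=> N t /=; rewrite in_itv/= andbT => t0.
    by rewrite lee_fin normrM ler_wpM2r// KM.
by under eq_fun do rewrite intK; exact: lim_cst.
Qed.

Lemma laplace_tail_eq0 x : 0 <= x ->
  (\int[mu]_(t in `]x, +oo[) (expR (- t) * D t)%:E = 0)%E.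
Proof.
(* At t = x the kernel equals exp(-1) for every n and does not tend to the indicator of t > x; this
   null point is removed. *)
move=> x0; pose I := (`[0%R, +oo[ `\ x : set R).
have mI : measurable I by exact: measurableD.
have intI : mu.-integrable I (EFin \o g) by apply: integrableS intD => // t [].
have mGn n : measurable_fun setT (fun t => expR (- expR (n%:R * (x - t)))).
  apply: measurableT_comp => //; apply: measurableT_comp => //.
  exact: measurable_expR_affine.
have lim0 : (\int[mu]_(t in I) (expR (- expR (n.+1%:R * (x - t))) * g t)%:E)%E @[n --> \oo]
    --> (\int[mu]_(t in I) ((EFin \o g) \_ `]x, +oo[ t))%E.
  apply: (@dominated_cvg _ _ _ mu _ _ _ _ (fun t => `|(g t)%:E|%E)) => //.
  - move=> n; apply/measurable_EFinP/measurable_funM; first (by apply: measurable_funTS; exact: mGn).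
    by apply/measurable_EFinP; exact: measurable_int intI.
  - move=> t [t0 /= tx]; rewrite patchE; case: ifPn.
      rewrite inE/= in_itv/= andbT => xt; apply/cvg_EFin; first exact: nearW.
      rewrite -[X in _ --> X]mul1r; apply: cvgM (cvg_cst _).
      have := @cvg_expRNexpR _ (x - t); rewrite subr_lt0 xt; apply.
      by rewrite subr_eq0 lt_eqF.
    rewrite notin_setE/= in_itv/= andbT => /negP; rewrite -leNgt => tx'.
    have {}tx : t < x by rewrite lt_neqAle tx' andbT; exact/eqP.
    apply/cvg_EFin; first exact: nearW.
    rewrite -[X in _ --> X](mul0r (g t)); apply: cvgM (cvg_cst _).
    have := @cvg_expRNexpR _ (x - t); rewrite subr_lt0 ltNge (ltW tx); apply.
    by rewrite subr_eq0 gt_eqF.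
  - exact: integrable_abse.
  - move=> n t _; rewrite lee_fin normrM ler_piMl// ger0_norm ?expR_ge0//.
have : (\int[mu]_(t in I) (expR (- expR (n.+1%:R * (x - t))) * g t)%:E)%E @[n --> \oo]
    --> 0%E.
  rewrite (_ : (fun _ => _) = cst 0%E); first exact: cvg_cst.
  apply/funext => n; rewrite integral_setD1 ?gumbel_orthogonal//.
  apply/measurable_EFinP/measurable_funM; first (by apply: measurable_funTS; exact: mGn).
  by apply/measurable_EFinP; exact: measurable_int intI.
move=> /(cvg_unique _ lim0) <- //; rewrite -integral_mkcondr; congr integral.
apply/seteqP; split => [t /= xt|t []//]; split => //.
move: xt; rewrite in_itv/= andbT => xt.
split; last by apply/eqP; rewrite gt_eqF.
by rewrite /= in_itv/= andbT (le_trans x0)// ltW.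
Qed.

End laplace_uniqueness.

Section laplace_injectivity.
Context {R : realType}.
Local Notation mu := (@lebesgue_measure R).
Implicit Types (x y t : R) (n : nat).

Lemma integral_gt0_lbound (G : R -> R) (x y K : R) : x < y -> 0 < K ->
  mu.-integrable `]x, y] (EFin \o G) -> (forall t, x < t <= y -> K <= G t) ->
  (0 < \int[mu]_(t in `]x, y]) (G t)%:E)%E.
Proof.
move=> xy K0 intG KG.
apply: (@lt_le_trans _ _ (\int[mu]_(t in `]x, y]) (cst K%:E t))%E).
  rewrite integral_cst//= lebesgue_measure_itv/= lte_fin xy -EFinB -EFinM lte_fin.
  by rewrite mulr_gt0// subr_gt0.
apply: le_integral => //.
  apply/integrableP; split => //.
  rewrite (eq_integral (cst K%:E)); last by move=> t _; rewrite /= gtr0_norm.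
  by rewrite integral_cst//= lebesgue_measure_itv/= lte_fin xy -EFinB -EFinM ltry.
by move=> t; rewrite inE/= in_itv/= => txy; rewrite lee_fin KG.
Qed.

Variables (phi psi : R -> R) (n0 : nat).
Hypothesis mphi : measurable_fun setT phi.
Hypothesis mpsi : measurable_fun setT psi.
Hypothesis phi_ge0 : forall t, 0 <= t -> 0 <= phi t.
Hypothesis psi_ge0 : forall t, 0 <= t -> 0 <= psi t.
Hypothesis phi_cont : forall t, 0 < t -> {for t, continuous phi}.
Hypothesis psi_nd : forall s t, 0 <= s -> s <= t -> psi s <= psi t.
Hypothesis laplace_eq : forall n, (n0 < n)%N ->
  (\int[mu]_(t in `[0%R, +oo[) (expR (- (n%:R * t)) * phi t)%:E =
   \int[mu]_(t in `[0%R, +oo[) (expR (- (n%:R * t)) * psi t)%:E)%E.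
Hypothesis laplace_lty : forall n, (n0 < n)%N ->
  (\int[mu]_(t in `[0%R, +oo[) (expR (- (n%:R * t)) * phi t)%:E < +oo)%E.

Let integrable_laplace (f : R -> R) n : measurable_fun setT f ->
  (forall t, 0 <= t -> 0 <= f t) ->
  (\int[mu]_(t in `[0%R, +oo[) (expR (- (n%:R * t)) * f t)%:E < +oo)%E ->
  mu.-integrable `[0%R, +oo[ (fun t => (expR (- (n%:R * t)) * f t)%:E).
Proof.
move=> mf f0 foo; apply/integrableP; split.
  apply/measurable_EFinP/measurable_funTS/measurable_funM => //.
  by under eq_fun do rewrite -mulrN -[- _]add0r; exact: measurable_expR_affine.
apply: le_lt_trans foo; rewrite le_eqVlt; apply/orP; left; apply/eqP.
apply: eq_integral => t; rewrite inE/= in_itv/= andbT => t0.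
by rewrite ger0_norm// mulr_ge0 ?expR_ge0 ?f0.
Qed.

(** The exponential factor shifts transforms that vanish at the integers above [n0] to transforms
    that vanish at all positive integers, as [laplace_tail_eq0] requires. *)
Let D t := expR (- (n0%:R * t)) * (phi t - psi t).

Let DE n t : ((expR (- (n%:R * t)) * D t)%:E =
  (expR (- ((n + n0)%:R * t)) * phi t)%:E - (expR (- ((n + n0)%:R * t)) * psi t)%:E)%E.
Proof.
by rewrite -EFinB /D mulrA -expRD -mulrBr natrD mulrDl opprD.
Qed.

Let intphi n : (0 < n)%N ->
  mu.-integrable `[0%R, +oo[ (fun t => (expR (- ((n + n0)%:R * t)) * phi t)%:E).
Proof.
by move=> n_gt0; apply: integrable_laplace => //; apply: laplace_lty; rewrite -add1n leq_add.
Qed.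

Let intpsi n : (0 < n)%N ->
  mu.-integrable `[0%R, +oo[ (fun t => (expR (- ((n + n0)%:R * t)) * psi t)%:E).
Proof.
move=> n_gt0; have n0n : (n0 < n + n0)%N by rewrite -add1n leq_add.
by apply: integrable_laplace => //; rewrite -laplace_eq// laplace_lty.
Qed.

Let intD : mu.-integrable `[0%R, +oo[ (fun t => (expR (- t) * D t)%:E).
Proof.
rewrite (_ : (fun _ => _) = (fun t => (expR (- ((1 + n0)%:R * t)) * phi t)%:E
    - (expR (- ((1 + n0)%:R * t)) * psi t)%:E)%E).
  by apply: integrableB => //; [exact: intphi|exact: intpsi].
by apply/funext => t; rewrite -DE mul1r.
Qed.

Let tail0 x : 0 <= x -> (\int[mu]_(t in `]x, +oo[) (expR (- t) * D t)%:E = 0)%E.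
Proof.
apply: laplace_tail_eq0 => // n n_gt0.
under eq_integral do rewrite DE.
have n0n : (n0 < n + n0)%N by rewrite -add1n leq_add.
rewrite integralB//; [|exact: intphi|exact: intpsi].
rewrite laplace_eq// subee// ge0_fin_numE; last first.
  apply: integral_ge0 => t; rewrite /= in_itv/= andbT => t0.
  by rewrite lee_fin mulr_ge0 ?expR_ge0 ?psi_ge0.
by rewrite -laplace_eq// laplace_lty.
Qed.

Let itv0 x y : 0 <= x -> x < y -> (\int[mu]_(t in `]x, y]) (expR (- t) * D t)%:E = 0)%E.
Proof.
move=> x0 xy; have := tail0 x0.
rewrite (_ : `]x, +oo[%classic = `]x, y] `|` `]y, +oo[); last first.
  by rewrite -itv_bndbnd_setU// bnd_simp ltW.
rewrite integral_setU//=.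
- by rewrite tail0 ?adde0// (le_trans x0)// ltW.
- rewrite -itv_bndbnd_setU ?bnd_simp ?ltW//.
  apply: measurable_funS (measurable_int _ intD) => // t.
  by rewrite /= !in_itv/= !andbT => /ltW; exact: le_trans.
- apply/disj_set2P; apply/seteqP; split => t //= [].
  by rewrite !in_itv/= andbT => /andP[_ ty] /(le_lt_trans ty); rewrite ltxx.
Qed.

(* On a short interval to the right (resp. left) of a point where phi < psi
   (resp. phi > psi), continuity of phi and monotonicity of psi keep phi - psi
   away from 0. *)
Lemma laplace_injective x : 0 < x -> phi x = psi x.
Proof.
move=> x0.
have intDxy a b : 0 <= a -> mu.-integrable `]a, b] (fun t => (expR (- t) * D t)%:E).
  move=> a0; apply: integrableS intD => // t; rewrite /= !in_itv/= andbT.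
  by move=> /andP[at_ _]; rewrite (le_trans a0)// ltW.
have expD t : expR (- t) * D t = expR (- ((1 + n0%:R) * t)) * (phi t - psi t).
  by rewrite /D mulrA -expRD mulrDl mul1r opprD.
have near_c (e : R) : 0 < e -> exists2 d, 0 < d &
    forall t, `|x - t| < d -> `|phi x - phi t| < e.
  move=> e0; have /cvgrPdist_lt/(_ _ e0)/nbhs_ballP[d /= d0 dphi] := phi_cont x0.
  by exists d => // t; exact: dphi.
have e_gt0 a b : a < b -> 0 < (b - a) / 2 :> R by move=> ab; rewrite divr_gt0 ?subr_gt0.
have [phi_lt|psi_lt|//] := ltgtP (phi x) (psi x).
  have [d d0 dphi] := near_c _ (e_gt0 _ _ phi_lt).
  have xd : x < x + d / 2 by rewrite ltrDl divr_gt0.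
  suff : (0 < \int[mu]_(t in `]x, (x + d / 2)%R]) (- (expR (- t) * D t))%:E)%E.
    under eq_integral do rewrite EFinN.
    rewrite integralN; last exact/integrable_add_def/intDxy/ltW.
    by rewrite (itv0 (ltW x0) xd) oppe0 ltxx.
  apply: (integral_gt0_lbound
    (K := expR (- ((1 + n0%:R) * (x + d / 2))) * ((psi x - phi x) / 2))) => //.
  - by rewrite mulr_gt0 ?expR_gt0 ?e_gt0.
  - rewrite (_ : EFin \o _ = (\- (fun t => (expR (- t) * D t)%:E))%E)//.
    by apply: integrableN => //; exact/intDxy/ltW.
  - move=> t /andP[xt td]; rewrite expD -[X in _ <= X]mulrN opprB; apply: ler_pM.
    + exact: expR_ge0.
    + exact/ltW/e_gt0.
    + by rewrite ler_expR lerN2 ler_wpM2l// addr_ge0.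
    + have := psi_nd (ltW x0) (ltW xt).
      have /dphi : `|x - t| < d.
        rewrite distrC gtr0_norm ?subr_gt0// ltrBlDl (le_lt_trans td)// ltrD2l.
        by rewrite ltr_pdivrMr// ltr_pMr// ltr1n.
      by rewrite ltr_norml => /andP[]; lra.
have [d d0 dphi] := near_c _ (e_gt0 _ _ psi_lt).
(* Being at least x / 2 keeps the left end point positive, where integrals over intervals are known
   to vanish and [psi] is monotone. *)
pose y := Num.max (x / 2) (x - d / 2).
have y0 : 0 < y by rewrite lt_max divr_gt0.
have yx : y < x by rewrite gt_max ltr_pdivrMr// ltr_pMr ?ltr1n//= ltrBlDr ltrDl divr_gt0.
suff : (0 < \int[mu]_(t in `]y, x]) (expR (- t) * D t)%:E)%E.
  by rewrite (itv0 (ltW y0) yx) ltxx.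
apply: (integral_gt0_lbound
  (K := expR (- ((1 + n0%:R) * x)) * ((phi x - psi x) / 2))) => //.
- by rewrite mulr_gt0 ?expR_gt0 ?e_gt0.
- exact: intDxy (ltW y0).
- move=> t /andP[yt tx]; rewrite expD; apply: ler_pM.
  + exact: expR_ge0.
  + exact/ltW/e_gt0.
  + by rewrite ler_expR lerN2 ler_wpM2l// addr_ge0.
  + have := psi_nd (ltW (lt_trans y0 yt)) tx.
    have /dphi : `|x - t| < d.
      rewrite ger0_norm ?subr_ge0// ltrBlDr -ltrBlDl.
      move: yt; rewrite gt_max => /andP[_]; apply: le_lt_trans.
      by rewrite lerD2l lerN2 ler_pdivrMr// ler_pMr// ler1n.
    by rewrite ltr_norml => /andP[]; lra.
Qed.

End laplace_injectivity.

(** * Exponential laws and Laplace transforms *)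

Lemma integral_cst_probability {R : realType} {d} {T : measurableType d}
  (P : probability T R) (c : R) : (\int[P]_w c%:E = c%:E)%E.
Proof. by rewrite (integral_cst _ _ c%:E)// [X in (_ * X)%E](probability_setT P) mule1. Qed.

Section exponential_law.
Context {R : realType}.
Local Notation mu := (@lebesgue_measure R).
Variable rate : R.
Hypothesis rate_gt0 : 0 < rate.

Definition exponential_law : probability (measurableTypeR R) R :=
  exponential_distribution_exponential_prob__canonical__probability_measure_Probability
    rate_gt0.

Lemma exponential_law_dominates : exponential_law `<< mu.
Proof.
apply/null_content_dominatesP => A mA muA0.
apply: null_set_integral => //.
by apply/measurable_EFinP/measurable_funTS; exact: measurable_exponential_pdf.
Qed.

Lemma integral_exponential_law (f : R -> \bar R) :
  measurable_fun setT f -> (forall x, 0 <= f x)%E ->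
  (\int[exponential_law]_x f x =
   \int[mu]_(x in `[0%R, +oo[) ((rate * expR (- (rate * x)))%:E * f x))%E.
Proof.
move=> mf f0.
rewrite -(Radon_Nikodym_SigmaFinite.change_of_variables exponential_law_dominates)//.
have pdfE : ((fun x => (rate * expR (- (rate * x)))%:E * f x)%E \_ `[0%R, +oo[) =
    (fun x => f x * (exponential_pdf rate x)%:E)%E.
  apply/funext => x; rewrite /exponential_pdf !patchE; case: ifPn => _.
    by rewrite muleC mulNr.
  by rewrite mule0.
have mpdf := measurable_exponential_pdf rate.
rewrite [RHS]integral_mkcond pdfE; apply: ae_eq_integral => //.
- apply: emeasurable_funM => //.
  exact: measurable_int (Radon_Nikodym_SigmaFinite.f_integrable exponential_law_dominates).
- by apply: emeasurable_funM => //; exact/measurable_EFinP.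
(* The Radon-Nikodym derivative is determined almost everywhere only; it agrees there with the
   density because both have the same integral over every measurable set. *)
- apply: ae_eqe_mul2l; apply: integral_ae_eq => //.
  + exact: (Radon_Nikodym_SigmaFinite.f_integrable exponential_law_dominates).
  + exact/measurable_EFinP.
  + move=> A _ mA.
    by rewrite -(Radon_Nikodym_SigmaFinite.f_integral exponential_law_dominates).
Qed.

Lemma cvg_expRNM : expR (- (rate * t)) @[t --> +oo%R] --> (0 : R).
Proof.
rewrite (_ : (fun t => _) = (fun z => expR (- z)) \o (fun z => rate * z))//.
apply: (@cvg_comp _ _ _ _ _ _ (pinfty_nbhs R)); last exact: cvgr_expR.
exact: gt0_cvgMry.
Qed.

(** The side [b] is left free because open and closed rays both occur in the sandwich that computes
    the law of the inverse process at an exponential time. *)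
Lemma exponential_law_bndy b x : 0 <= x ->
  (exponential_law [set` Interval (BSide b x) +oo%O] = (expR (- (rate * x)))%:E)%E.
Proof.
move=> x0; rewrite /exponential_law/= /exponential_prob.
transitivity (\int[mu]_(t in `[x, +oo[) (exponential_pdf rate t)%:E)%E.
  case: b => //; rewrite integral_itv_obnd_cbnd//.
  by apply/measurable_EFinP/measurable_funTS; exact: measurable_exponential_pdf.
have cF : continuous (fun t : R^o => - expR (- rate * t)).
  move=> t; apply: cvgN; apply: continuous_comp; last exact: continuous_expR.
  by apply: continuousM => //; exact: cst_continuous.
rewrite (@ge0_continuous_FTC2y _ _ (fun t => - expR (- rate * t)) _ 0).
- by rewrite EFinN oppeK add0e mulNr.
- by move=> t _; exact/exponential_pdf_ge0/ltW.
- apply: (@continuous_subspaceW R^o _ _ [set` `[0, +oo[%R]); last first.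
    exact: within_continuous_exponential_pdf.
  move=> t; by rewrite /= !in_itv/= !andbT; exact: le_trans.
- rewrite -oppr0; apply: cvgN.
  by under eq_fun do rewrite mulNr; exact: cvg_expRNM.
- by move=> t _; exact: ex_derive.
- by apply/cvg_at_right_filter; exact: cF.
- move=> t; rewrite in_itv/= andbT => xt; rewrite derive1_exponential_pdf//.
  by rewrite in_itv/= andbT (le_lt_trans x0).
Qed.

End exponential_law.

(** Open rays are stable under intersection and generate the Borel sets, so survival functions
    identify laws. *)
Lemma probability_ray_unique {R : realType} (P1 P2 : probability (measurableTypeR R) R) :
  (forall x, P1 `]x, +oo[%classic = P2 `]x, +oo[%classic) ->
  forall A, measurable A -> P1 A = P2 A.
Proof.
move=> P12.
apply: (@measure_unique _ _ (measurableTypeR R) [set A | exists x : R, A = `]x, +oo[%classic]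
   (fun n => `](- n%:R), +oo[%classic)).
- exact: RGenOInfty.measurableE.
- move=> _ _ [x ->] [y ->]; exists (Num.max x y).
  apply/predeqP => t /=; rewrite !in_itv/= !andbT gt_max.
  by split=> [[-> ->]|/andP[]].
- by move=> n; exists (- n%:R).
- apply/seteqP; split => // x _; exists (Num.bound `|x|) => //=.
  rewrite in_itv/= andbT ltrNl (le_lt_trans _ (archi_boundP _))//.
  by rewrite -normrN ler_norm.
- by move=> _ [x ->]; exact: P12.
- by move=> n; rewrite (le_lt_trans (probability_le1 _ _))// ltry.
Qed.

(** * The inverse subordinator *)

Lemma measurable_ltr_set {d} {T : measurableType d} {R : realType} (f g : T -> R) :
  measurable_fun setT f -> measurable_fun setT g -> measurable [set x | f x < g x].
Proof.
move=> mf mg; rewrite (_ : [set x | _] = setT `&` (fun x => f x < g x) @^-1` [set true]).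
  by apply: (measurable_fun_ltr mf mg) => //.
by rewrite setTI.
Qed.

Lemma measurable_ler_set {d} {T : measurableType d} {R : realType} (f g : T -> R) :
  measurable_fun setT f -> measurable_fun setT g -> measurable [set x | f x <= g x].
Proof.
move=> mf mg; rewrite (_ : [set x | _] = ~` [set x | g x < f x]).
  by apply: measurableC; exact: measurable_ltr_set.
by apply/predeqP => x /=; rewrite leNgt; split => /negP.
Qed.

Section inverse_process.
Context {R : realType} {d} {T : measurableType d} (sigma : R -> T -> R).
Hypothesis sigma_nd : forall w (s t : R), 0 <= s -> s <= t -> sigma s w <= sigma t w.
Local Notation L := (inverse_process sigma).

Let has_lb t w : has_lbound [set s | 0 <= s /\ t < sigma s w].
Proof. by exists 0 => s []. Qed.

Lemma inverse_process_ge0 t w : 0 <= L t w.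
Proof.
have [S0|/set0P S0] := eqVneq [set s | 0 <= s /\ t < sigma s w] set0.
  by rewrite /inverse_process S0 inf0.
by apply: lb_le_inf => // s [].
Qed.

Lemma inverse_process_le t w s : 0 <= s -> t < sigma s w -> L t w <= s.
Proof. by move=> s0 ts; apply: ge_inf. Qed.

(** The first hypothesis excludes the empty set, whose infimum is 0 by convention and is approached
    by no element. *)
Lemma inverse_process_lt t w s : (exists n, t < sigma n%:R w) -> L t w < s ->
  exists2 u, 0 <= u < s & t < sigma u w.
Proof.
move=> [n tn] Ls; have [|u [u0 tu] us] := inf_lt _ Ls; last by exists u; rewrite ?u0.
by exists n%:R; split.
Qed.

Lemma inverse_process_le_sigma t w s : 0 <= s -> (exists n, t < sigma n%:R w) ->
  L t w < s -> t < sigma s w.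
Proof.
move=> s0 tn /(inverse_process_lt tn)[u /andP[u0 us] tu].
by rewrite (lt_le_trans tu)// sigma_nd// ltW.
Qed.

(** Monotonicity of [sigma] reduces the times to rational ones, so that the event is a countable
    union. The second alternative is the path bounded by t, for which the infimum is over the empty
    set and equals 0 < s. *)
Lemma inverse_process_ltE t w (s : R) : 0 < s ->
  (L t w < s) <-> (exists q : rat, 0 <= (ratr q : R) < s /\ t < sigma ((ratr q : R)) w) \/
                  (forall n, sigma n%:R w <= t).
Proof.
move=> s0; split => [Ls|[[q [/andP[q0 qs] tq]]|tn]].
- have [tn|tn] := pselect (exists n, t < sigma n%:R w).
    left; have [u /andP[u0 us] tu] := inverse_process_lt tn Ls.
    have [q] := rat_in_itvoo us; rewrite in_itv/= => /andP[uq qs]; exists q.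
    by rewrite qs (le_trans u0 (ltW uq)); split=> //; rewrite (lt_le_trans tu)// sigma_nd// ltW.
  right=> n; rewrite leNgt; apply/negP => tn'; apply: tn; by exists n.
- by rewrite (le_lt_trans _ qs)// inverse_process_le.
- rewrite /inverse_process (_ : [set _ | _] = set0) ?inf0//.
  apply/seteqP; split => // u [u0]; rewrite ltNge => /negP; apply.
  by apply: le_trans (tn (Num.bound u)); rewrite sigma_nd// ltW// archi_boundP.
Qed.

Lemma inverse_process_lt_set t (s : R) : 0 < s ->
  [set w | L t w < s] =
  (\bigcup_(q : rat) (if 0 <= (ratr q : R) < s then [set w | t < sigma ((ratr q : R)) w] else set0))
  `|` \bigcap_n [set w | sigma n%:R w <= t].
Proof.
move=> s0; apply/predeqP => w /=; rewrite (inverse_process_ltE _ _ s0).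
split => [[[q [qs tq]]|tn]|[[q _]|tn]].
- by left; exists q => //; rewrite qs.
- by right=> n _; exact: tn.
- by case: ifPn => // qs tq; left; exists q.
- by right=> n; exact: tn.
Qed.

End inverse_process.

Section inverse_process_measurable.
Context {R : realType} {d} {T : measurableType d} (sigma : R -> T -> R).
Hypothesis sigma_nd : forall w (s t : R), 0 <= s -> s <= t -> sigma s w <= sigma t w.
Hypothesis msigma : forall t, 0 <= t -> measurable_fun setT (sigma t).

(** Joint measurability in time and randomness is what lets Tonelli put an independent exponential
    time in place of t. It needs [sigma] at countably many fixed times only. *)
Lemma measurable_inverse_process :
  measurable_fun setT
    (fun z : measurableTypeR R * T => inverse_process sigma z.1 z.2).
Proof.
apply: (measurability (@RGenInftyO.G R)); first exact: RGenInftyO.measurableE.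
move=> _ [_ [s ->] <-]; rewrite setTI.
have [s0|s0] := leP s 0.
  rewrite (_ : _ @^-1` _ = set0)//; apply/seteqP; split => // z /=.
  rewrite in_itv/= => /lt_le_trans/(_ s0).
  by rewrite ltNge inverse_process_ge0.
rewrite (_ : _ @^-1` _ =
  (\bigcup_(q : rat) (if 0 <= (ratr q : R) < s then
      [set z : measurableTypeR R * T | z.1 < sigma ((ratr q : R)) z.2] else set0))
  `|` \bigcap_n [set z : measurableTypeR R * T | sigma n%:R z.2 <= z.1]); last first.
  apply/predeqP => -[t w]; have := inverse_process_lt_set sigma_nd t s0.
  move/predeqP/(_ w) => /=; rewrite in_itv/= => ->.
  split => -[[q _]|tn]; [|by right|  |by right]; move=> h; left; exists q => //; move: h.
    by case: ifPn.
  by case: ifPn.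
have msig t : 0 <= t -> measurable_fun setT (fun z : measurableTypeR R * T => sigma t z.2).
  by move=> t0; apply: measurableT_comp; [exact: msigma|exact: measurable_snd].
apply: measurableU.
  apply: bigcupT_measurable_rat => q; case: ifPn => // /andP[q0 _].
  by apply: measurable_ltr_set; [exact: measurable_fst|exact: msig].
apply: bigcapT_measurable => n.
by apply: measurable_ler_set; [exact: msig|exact: measurable_fst].
Qed.

End inverse_process_measurable.

Section stable_subordinator.
Context {R : realType} {d} {T : measurableType d} (P : probability T R).
Variables (nu : R) (sigma : R -> T -> R).
Hypothesis nu_gt0 : 0 < nu.
Hypothesis sigmaP : is_stable_subordinator P nu sigma.
Local Notation L := (inverse_process sigma).

Let msigma : forall t, 0 <= t -> measurable_fun setT (sigma t).
Proof. by case: sigmaP. Qed.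

Let sigma_nd w (s t : R) : 0 <= s -> s <= t -> sigma s w <= sigma t w.
Proof. by case: sigmaP => _ _ [+ _] _ _ => /(_ w); apply. Qed.

Let sigma_rc w (t : R) : 0 <= t -> sigma s w @[s --> t^'+] --> sigma t w.
Proof. by case: sigmaP => _ _ [_ +] _ _; apply. Qed.

Let sigma_laplace t v : 0 <= t -> 0 < v ->
  (\int[P]_w (expR (- (v * sigma t w)))%:E = (expR (- (t * v `^ nu)))%:E)%E.
Proof. by case: sigmaP => _ _ _ _ + t0 v0 => /(_ _ _ t0 v0); rewrite unlock. Qed.

Let mexp t v : 0 <= t -> measurable_fun setT (fun w => expR (- (v * sigma t w))).
Proof.
move=> t0; apply: measurableT_comp => //; apply: measurableT_comp => //.
by apply: measurable_funM => //; exact: msigma.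
Qed.

(** Chernoff bound: the indicator of sigma_s <= t is at most exp(v (t - sigma_s)), whose expectation
    is known. *)
Lemma subordinator_chernoff (s t v : R) : 0 <= s -> 0 < v ->
  (P [set w | (sigma s w <= t)%R] <= (expR (v * t - s * v `^ nu))%:E)%E.
Proof.
move=> s0 v0; have mA : measurable [set w | sigma s w <= t].
  by apply: measurable_ler_set => //; exact: msigma.
rewrite expRD EFinM -(sigma_laplace s0 v0) -ge0_integralZl//; last first.
  by apply/measurable_EFinP; exact: mexp.
rewrite -[X in P X]setIT -integral_indic//; apply: ge0_le_integral => //.
- exact/measurable_EFinP/measurable_indic.
- by apply: measurable_funeM; apply/measurable_EFinP; exact: mexp.
- move=> w _; rewrite -EFinM lee_fin indicE; case: (boolP (_ \in _)) => [|_].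
    rewrite inE /= => st; rewrite -expRD -mulrBr -[X in X <= _](@expR0 R).
    by rewrite ler_expR mulr_ge0 ?subr_ge0// ltW.
  by rewrite mulr_ge0 ?expR_ge0.
Qed.

Lemma ae_sigma_eq0 : \forall w \ae P, sigma 0 w = 0.
Proof.
have mA : measurable [set w | sigma 0 w = 0].
  rewrite (_ : [set w | _] = setT `&` sigma 0 @^-1` [set 0]) ?setTI//.
  by rewrite -[X in measurable X]setTI; exact: msigma.
exists (~` [set w | sigma 0 w = 0]); split => //; first exact: measurableC.
by rewrite probability_setC//; case: sigmaP => _ -> _ _ _; rewrite subee.
Qed.

Lemma ae_sigma_gt0 (s : R) : 0 < s -> \forall w \ae P, 0 < sigma s w.
Proof.
move=> s0; exists [set w | sigma s w <= 0]; split.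
- by apply: measurable_ler_set => //; exact/msigma/ltW.
- apply/eqP; rewrite eq_le measure_ge0 andbT.
  apply/lee_addgt0Pr => e e0; rewrite add0e.
  (* The Chernoff bound is used at t = 0 with v = n^(1/nu), so that v^nu = n and the bound exp(- s
     n) is at most e. *)
  pose n := Num.bound `|- ln e / s|.
  have n0 : 0 < n%:R :> R by rewrite (le_lt_trans (normr_ge0 (- ln e / s)))// archi_boundP.
  apply: le_trans (subordinator_chernoff 0 (ltW s0) (powR_gt0 nu^-1 n0)) _.
  rewrite mulr0 add0r -powRrM mulVf ?gt_eqF// powRr1 ?(ltW n0)// lee_fin.
  rewrite -[leRHS]lnK ?posrE// ler_expR lerNl mulrC -ler_pdivrMr//.
  by rewrite (le_trans (ler_norm _))// ltW// archi_boundP.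
- by move=> w /= /negP; rewrite leNgt.
Qed.

Lemma ae_sigma_unbounded : \forall w \ae P, forall t, exists n, t < sigma n%:R w.
Proof.
suff : \forall w \ae P, forall m : nat, exists n, m%:R < sigma n%:R w.
  apply: filterS => w mn t; have [n tn] := mn (Num.bound `|t|); exists n.
  by rewrite (le_lt_trans _ tn)// (le_trans (ler_norm _))// ltW// archi_boundP.
apply: ae_foralln => m; exists (\bigcap_n [set w | sigma n%:R w <= m%:R]); split.
- by apply: bigcapT_measurable => n; apply: measurable_ler_set => //; exact: msigma.
- apply/eqP; rewrite eq_le measure_ge0 andbT.
  apply/lee_addgt0Pr => e e0; rewrite add0e.
  (* The Chernoff bound with v = 1 at time n is exp(m - n), which this choice brings below e. *)
  pose n := Num.bound (`|m%:R - ln e|).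
  apply: (@le_trans _ _ (P [set w | (sigma n%:R w <= m%:R)%R])).
    apply: le_measure; rewrite ?inE.
    + apply: bigcapT_measurable => k; apply: measurable_ler_set => //; exact: msigma.
    + by apply: measurable_ler_set => //; exact: msigma.
    + by move=> w /(_ n I).
  apply: le_trans (subordinator_chernoff m%:R (ler0n _ n) ltr01) _.
  rewrite mul1r powR1 mulr1 lee_fin -[leRHS]lnK ?posrE// ler_expR lerBlDr -lerBlDl.
  by rewrite (le_trans (ler_norm _))// ltW// archi_boundP.
- by move=> w /= /forallNP wm n _ /=; rewrite leNgt; exact/negP.
Qed.

(** Almost surely sigma is positive at all times 1/(m+1), so the infimum is below each of them. This
    identifies the initial states of the fractional and of the classical queue. *)
Lemma ae_inverse_process0 : \forall w \ae P, L 0 w = 0.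
Proof.
have : \forall w \ae P, forall m : nat, 0 < sigma m.+1%:R^-1 w.
  by apply: ae_foralln => m; apply: ae_sigma_gt0; rewrite invr_gt0.
apply: filterS => w s0; apply/eqP; rewrite eq_le inverse_process_ge0 andbT.
apply/ler_addgt0Pr => e e0; rewrite add0r.
have [m me] := ltr_add_invr e0; rewrite add0r in me.
by rewrite (le_trans _ (ltW me))// inverse_process_le.
Qed.

(** Monotonicity holds almost surely only: on a bounded path the infimum over the empty set makes L
    fall back to 0. *)
Lemma ae_inverse_process_nd : \forall w \ae P, forall s t, s <= t -> L s w <= L t w.
Proof.
apply: filterS ae_sigma_unbounded => w tn s t st.
rewrite leNgt; apply/negP => /(inverse_process_lt (tn t))[u /andP[u0 us] tu].
by move: us; rewrite ltNge inverse_process_le// (le_lt_trans st).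
Qed.

Let measurable_L : measurable_fun setT (fun z : measurableTypeR R * T => L z.1 z.2).
Proof. exact: measurable_inverse_process. Qed.

Let mray w x : measurable [set t : measurableTypeR R | x < L t w].
Proof.
apply: measurable_ltr_set => //.
exact: (measurableT_comp measurable_L (measurable_pair2 w)).
Qed.

(* Up to a null set, L_t > x as soon as sigma_x < t, and only if sigma_x <= t. *)
Let exponential_time_ray v (v0 : 0 < v) x : 0 <= x ->
  \forall w \ae P, (exponential_law v0 [set t | (x < L t w)%R] =
    (expR (- (v * sigma x w)))%:E)%E.
Proof.
move=> x0.
apply: filterS2 ae_sigma_eq0 ae_sigma_unbounded => w s0 tn.
have sx0 : 0 <= sigma x w by rewrite -s0 sigma_nd.
have mA := mray w x.
apply/eqP; rewrite eq_le; apply/andP; split.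
  rewrite -(exponential_law_bndy v0 true sx0); apply: le_measure => //.
  - by rewrite inE.
  - by rewrite inE; exact: measurable_itv.
  - move=> t /= xL; rewrite in_itv/= andbT leNgt; apply/negP => tx.
    by move: xL; rewrite ltNge inverse_process_le.
rewrite -(exponential_law_bndy v0 false sx0); apply: le_measure => //.
- by rewrite inE; exact: measurable_itv.
- by rewrite inE.
- move=> t /=; rewrite in_itv/= andbT => xt.
  (* Right-continuity keeps sigma below t a little beyond x, which pushes L_t strictly above x. *)
  have /cvgr_lt/(_ _ xt)[e /= e0 sxe] := @sigma_rc w x x0.
  have /sxe xs : ball x e (x + e / 2).
    by rewrite /ball/= opprD addNKr normrN gtr0_norm ?divr_gt0// ltr_pdivrMr// ltr_pMr// ltr1n.
  have {}xs : sigma (x + e / 2) w < t by apply: xs; rewrite ltrDl divr_gt0.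
  apply: (@lt_le_trans _ _ (x + e / 2)); first by rewrite ltrDl divr_gt0.
  have xe0 : 0 <= x + e / 2 by rewrite addr_ge0// divr_ge0// ltW.
  rewrite leNgt; apply/negP => /(inverse_process_le_sigma sigma_nd xe0 (tn t)).
  by rewrite ltNge (ltW xs).
Qed.

(** For an independent exponential time S of rate v, L_S > x is S > sigma_x up to a null event, so
    its probability is E exp(- v sigma_x) = exp(- x v^nu), the survival function of the exponential
    law of rate v^nu. *)
Lemma exponential_time_inverse v (v0 : 0 < v) (vnu0 : 0 < v `^ nu) (f : R -> \bar R) :
  measurable_fun setT f -> (forall x, 0 <= f x)%E ->
  (\int[exponential_law v0]_t \int[P]_w f (L t w) =
   \int[exponential_law vnu0]_s f s)%E.
Proof.
move=> mf f0.
have mL : measurable_fun setT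
    (fun z : measurableTypeR R * T => L z.1 z.2 : measurableTypeR R).
  exact: measurable_L.
pose X : {mfun (measurableTypeR R * T)%type >-> measurableTypeR R} :=
  HB.pack (fun z : measurableTypeR R * T => L z.1 z.2)
    (isMeasurableFun.Build _ _ _ _ _ mL).
have mfL : measurable_fun setT (fun z : measurableTypeR R * T => f (L z.1 z.2)).
  by apply: measurableT_comp => //; exact: measurable_L.
transitivity (\int[(exponential_law v0 \x P)%E]_z f (L z.1 z.2))%E.
  by rewrite fubini_tonelli1.
transitivity (\int[distribution (exponential_law v0 \x P)%E X]_s f s)%E.
  by rewrite ge0_integral_distribution.
apply: eq_measure_integral => A mA _.
apply: probability_ray_unique => // x.
have mX y : measurable [set z : measurableTypeR R * T | y < L z.1 z.2].
  exact: measurable_ltr_set.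
transitivity ((exponential_law v0 \x P)%E
    [set z : measurableTypeR R * T | (x < L z.1 z.2)%R]).
  apply: (congr1 (exponential_law v0 \x P)%E); apply/predeqP => z /=.
  by rewrite in_itv/= andbT.
have [x_lt0|x_ge0] := ltP x 0.
  rewrite (_ : [set z | _] = setT) ?probability_setT; last first.
    by apply/predeqP => z /=; split => // _; rewrite (lt_le_trans x_lt0)// inverse_process_ge0.
  apply/esym/eqP; rewrite eq_le; apply/andP; split; first exact: probability_le1.
  have := exponential_law_bndy vnu0 true (lexx 0); rewrite mulr0 oppr0 expR0 => <-.
  apply: le_measure; rewrite ?inE//.
  by move=> t /=; rewrite !in_itv/= !andbT => /(lt_le_trans x_lt0).
rewrite (exponential_law_bndy vnu0 false x_ge0).
pose B := [set z : measurableTypeR R * T | x < L z.1 z.2].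
have mB : measurable B := mX x.
transitivity (\int[(exponential_law v0 \x P)%E]_z (\1_B z)%:E)%E.
  by rewrite integral_indic// setIT.
have m1 : measurable_fun setT (fun z : measurableTypeR R * T => (\1_B z)%:E : \bar R).
  exact/measurable_EFinP/measurable_indic.
rewrite fubini_tonelli2//.
rewrite mulrC -sigma_laplace//; apply: ae_eq_integral => //.
- exact: measurable_fun_fubini_tonelli_G.
- by apply/measurable_EFinP; exact: mexp.
- apply: filterS (exponential_time_ray v0 x_ge0) => w + _ => <-.
  rewrite /fubini_G -[X in exponential_law _ X]setIT -integral_indic//.
Qed.

End stable_subordinator.

(** * Moments of the inverse subordinator *)

Section exponential_moments.
Context {R : realType}.
Local Notation mu := (@lebesgue_measure R).

Lemma measurable_expRN (v : R) : measurable_fun setT (fun t : R => expR (- (v * t))).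
Proof.
by under eq_fun do rewrite -mulrN -[- _]add0r; exact: measurable_expR_affine.
Qed.

Lemma laplace_exponential_law v (v0 : 0 < v) (f : R -> \bar R) :
  measurable_fun setT f -> (forall t, 0 <= f t)%E ->
  (\int[mu]_(t in `[0%R, +oo[) ((expR (- (v * t)))%:E * f t) =
   v^-1%:E * \int[exponential_law v0]_t f t)%E.
Proof.
move=> mf f0; rewrite integral_exponential_law// -ge0_integralZl//.
- apply: eq_integral => t _.
  by rewrite muleA -EFinM mulrA mulVf ?gt_eqF// mul1r.
- apply: measurable_funTS; apply: emeasurable_funM => //.
  by apply/measurable_EFinP/measurable_funM => //; exact: measurable_expRN.
- by move=> t _; rewrite mule_ge0// lee_fin mulr_ge0 ?expR_ge0// ltW.
- by rewrite lee_fin invr_ge0 ltW.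
Qed.

Lemma exponential_law_scale v (v0 : 0 < v) (f : R -> \bar R) :
  measurable_fun setT f -> (forall t, 0 <= f t)%E ->
  (\int[exponential_law v0]_t f t = \int[exponential_law ltr01]_t f (t / v)%R)%E.
Proof.
move=> mf f0.
have mX : measurable_fun setT (fun t : measurableTypeR R => t / v : measurableTypeR R).
  exact: measurable_funM.
pose X : {mfun measurableTypeR R >-> measurableTypeR R} :=
  HB.pack (fun t : measurableTypeR R => t / v) (isMeasurableFun.Build _ _ _ _ _ mX).
transitivity (\int[distribution (exponential_law ltr01) X]_t f t)%E; last first.
  by rewrite ge0_integral_distribution.
apply: eq_measure_integral => A mA _.
apply: (@probability_ray_unique _ (exponential_law v0)
  (distribution (exponential_law ltr01) X)) => // x.
transitivity (exponential_law (@ltr01 R) `](v * x), +oo[%classic); last first.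
  apply: (congr1 (exponential_law ltr01)); apply/predeqP => t /=.
  by rewrite !in_itv/= !andbT ltr_pdivlMr// mulrC.
have [x0|x0] := leP 0 x; first by rewrite !exponential_law_bndy// ?mul1r// mulr_ge0// ltW.
have lt0_1 w (w0 : 0 < w) (y : R) : y < 0 ->
    exponential_law w0 `]y, +oo[%classic = 1%E.
  move=> y0; apply/eqP; rewrite eq_le; apply/andP; split; first exact: probability_le1.
  have := exponential_law_bndy w0 true (lexx 0); rewrite mulr0 oppr0 expR0 => <-.
  apply: le_measure; rewrite ?inE//.
  by move=> t /=; rewrite !in_itv/= !andbT => /(lt_le_trans y0).
by rewrite !lt0_1// pmulr_rlt0.
Qed.

(** The survival function of the Erlang law with n + 1 phases of rate 1: its opposite is the
    antiderivative of e^(-t) t^n / n! used to compute moments. *)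
Definition exp_partial n t : R := expR (- t) * series (exp_coeff t) n.+1.

Lemma exp_partialS n t :
  exp_partial n.+1 t = exp_partial n t + expR (- t) * (t ^+ n.+1 / n.+1`!%:R).
Proof. by rewrite /exp_partial /series/= big_nat_recr//= mulrDr. Qed.

(** The derivatives telescope: that of each added term e^(-t) t^(n+1) / (n+1)! cancels the previous
    density and leaves the next one. *)
Lemma is_derive_exp_partial n (t : R^o) :
  is_derive t 1 (exp_partial n : R^o -> R^o) (- (expR (- t) * (t ^+ n / n`!%:R))).
Proof.
elim: n => [|n IHn].
  rewrite (_ : (exp_partial 0 : R^o -> R^o) = (fun t => expR (- t))).
    by apply: is_derive_eq; rewrite expr0 fact0 invr1 !mulr1 mulrN1.
  apply/funext => u.
  by rewrite /exp_partial /series/= big_nat1 /exp_coeff/= expr0 fact0 invr1 !mulr1.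
have idX m (u : R^o) : ((id : R^o -> R^o) ^+ m) u = u ^+ m.
  by elim: m => // m IHm; rewrite !exprS -IHm.
have f0 : n`!%:R != 0 :> R by rewrite pnatr_eq0 -lt0n fact_gt0.
have n0 : n.+1%:R != 0 :> R by rewrite pnatr_eq0.
pose h (t : R^o) : R^o := expR (- t) * (t ^+ n.+1 * n.+1`!%:R^-1).
have dh : is_derive t 1 h (expR (- t) * (t ^+ n / n`!%:R) - h t).
  have d1 : is_derive t 1 (fun t : R^o => expR (- t) : R^o) (- expR (- t)).
    by apply: is_derive_eq; rewrite mulrN1.
  have d2 : is_derive t 1 ((id : R^o -> R^o) ^+ n.+1) (n.+1%:R * t ^+ n).
    by apply: is_derive_eq; rewrite /GRing.scale/= mulr1.
  have := is_deriveZ n.+1`!%:R^-1 (is_deriveM d1 d2).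
  rewrite (_ : _ \*: _ = h); last first.
    apply/funext => u; rewrite /h -(idX n.+1 u) /= /GRing.scale/=.
    by rewrite [LHS]mulrC -mulrA.
  move=> dh; apply: (is_derive_eq dh).
  by rewrite idX /h factS natrM !exprS /GRing.scale/=; field; rewrite f0 addrC natr1 n0.
have -> : (exp_partial n.+1 : R^o -> R^o) = (exp_partial n : R^o -> R^o) + h.
  by apply/funext => u; exact: exp_partialS.
by apply: (is_derive_eq (is_deriveD IHn dh)); rewrite addKr.
Qed.

End exponential_moments.

Section gamma_moments.
Context {R : realType}.
Local Notation mu := (@lebesgue_measure R).

Lemma cvg_exp_partial n : exp_partial n t @[t --> +oo%R] --> (0 : R).
Proof.
apply/(@cvgrPdist_lt _ R^o) => e e0; near=> t.
have t0 : 0 < t by near: t; exact: nbhs_pinfty_gt.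
have c0 k : 0 <= exp_coeff t k by apply: exp_coeff_ge0; exact: ltW.
rewrite sub0r normrN ger0_norm; last first.
  by rewrite mulr_ge0 ?expR_ge0//; apply: sumr_ge0 => k _.
(* Indeed t t^k / k! = (k+1) t^(k+1) / (k+1)!, and k + 1 <= n + 1, so t times the partial sum is at
   most (n+1) e^t. *)
apply: (@le_lt_trans _ _ (n.+1%:R / t)); last first.
  rewrite ltr_pdivrMr// mulrC -ltr_pdivrMr//; near: t.
  by apply: nbhs_pinfty_gt; rewrite num_real.
rewrite /exp_partial ler_pdivlMr// expRN -mulrA ler_pdivrMl ?expR_gt0// mulrC [leRHS]mulrC.
apply: le_trans (ler_wpM2l (ler0n _ n.+1) (series_exp_coeff_le n.+2 (ltW t0))).
rewrite [in leRHS]/series/= big_nat_recl//= mulrDr ler_wpDl ?mulr_ge0//.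
rewrite /series/= mulrC mulr_suml mulr_sumr; apply: ler_sum_nat => k /andP[_ kn].
apply: (@le_trans _ _ (k.+1%:R * exp_coeff t k.+1)); last first.
  by rewrite ler_wpM2r// ler_nat.
rewrite /exp_coeff/= factS natrM exprSr le_eqVlt; apply/orP; left; apply/eqP.
have f0 : k`!%:R != 0 :> R by rewrite pnatr_eq0 -lt0n fact_gt0.
have k0 : k.+1%:R != 0 :> R by rewrite pnatr_eq0.
by field; rewrite f0 addrC natr1 k0.
Unshelve. all: by end_near. Qed.

Let mpow x : measurable_fun setT (fun t : R => (t `^ x)%:E).
Proof. exact/measurable_EFinP. Qed.

Let pow_ge0 x (t : R) : (0 <= (t `^ x)%:E)%E.
Proof. by rewrite lee_fin powR_ge0. Qed.

Let cexp : continuous (fun t : R => expR (- t)).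
Proof. by move=> t; apply: continuous_comp; [exact: continuousN|exact: continuous_expR]. Qed.

Lemma integral_powRn_exponential n :
  (\int[exponential_law (@ltr01 R)]_t (t `^ n%:R)%:E = n`!%:R%:E)%E.
Proof.
have cint : continuous (fun t : R => expR (- t) * (t ^+ n / n`!%:R)).
  move=> t; apply: cvgM; first exact: cexp.
  by apply: cvgM (cvg_cst _); exact: exprn_continuous.
rewrite integral_exponential_law//.
transitivity (n`!%:R%:E * \int[mu]_(t in `[0%R, +oo[) (expR (- t) * (t ^+ n / n`!%:R))%:E)%E.
  rewrite -ge0_integralZl//.
  - apply: eq_integral => t; rewrite inE/= in_itv/= andbT => t0.
    rewrite powR_mulrn// -!EFinM !mul1r; congr EFin.
    by field; rewrite pnatr_eq0 -lt0n fact_gt0.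
  - apply/measurable_EFinP; apply: measurable_funTS; apply: continuous_measurable_fun.
    exact: cint.
  - move=> t /=; rewrite in_itv/= andbT => t0.
    by rewrite lee_fin mulr_ge0 ?expR_ge0// divr_ge0// exprn_ge0.
rewrite (@ge0_continuous_FTC2y _ _ (fun t => - exp_partial n t) _ 0).
- rewrite /exp_partial oppr0 expR0 mul1r series_exp_coeff0.
  by rewrite EFinN oppeK add0e mule1.
- by move=> t t0; rewrite mulr_ge0 ?expR_ge0// divr_ge0// exprn_ge0.
- exact: continuous_subspaceT.
- rewrite -oppr0; apply: cvgN; exact: cvg_exp_partial.
- by move=> t _; apply: derivableN; have [] := is_derive_exp_partial n t.
- apply: cvg_at_right_filter; apply: cvgN; have [dF _] := is_derive_exp_partial n (0 : R^o).
  have /differentiable_continuous : differentiable (exp_partial n : R^o -> R^o) (0 : R^o).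
    exact/derivable1_diffP.
  exact.
- move=> t _; rewrite derive1E deriveN; last by have [] := is_derive_exp_partial n t.
  by rewrite (@derive_val _ _ _ _ _ _ _ (is_derive_exp_partial n t)) opprK.
Qed.

(** [Gamma] is a real-valued integral, hence 0 by default if the integral is infinite; finiteness,
    by comparison with 1 + t^n for an integer n >= x, is what ties it to the moments. *)
Lemma integral_powR_exponential_fin x : 0 <= x ->
  (\int[exponential_law (@ltr01 R)]_t (t `^ x)%:E)%E \is a fin_num.
Proof.
move=> x0; rewrite ge0_fin_numE; last by apply: integral_ge0.
pose n := Num.bound x.
apply: (@le_lt_trans _ _ (\int[exponential_law (@ltr01 R)]_t (1%:E + (t `^ n%:R)%:E)))%E.
  apply: ge0_le_integral => //.
  - exact: mpow.
  - under eq_fun do rewrite -EFinD; apply/measurable_EFinP.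
    by apply: measurable_funD => //; exact: measurable_powR.
  move=> t _; rewrite -EFinD lee_fin.
  have [t0|t0] := ltP t 0.
    by rewrite {1}/powR lt_eqF// ln0 ?(ltW t0)// mulr0 expR0 lerDl powR_ge0.
  have [t1|t1] := leP t 1.
    apply: (@le_trans _ _ 1); last by rewrite lerDl powR_ge0.
    by have <- : 1 `^ x = 1 :> R by [rewrite powR1]; apply: ge0_ler_powR => //; rewrite nnegrE.
  rewrite (le_trans (ler_powR (ltW t1) (_ : x <= n%:R))) ?lerDr//.
  exact/ltW/archi_boundP.
rewrite ge0_integralD//; last exact: mpow.
rewrite integral_powRn_exponential.
suff -> : (\int[exponential_law (@ltr01 R)]_t 1%:E = 1)%E by rewrite -EFinD ltry.
by rewrite (@integral_cst _ _ _ _ _ measurableT 1%E) mul1e; exact: probability_setT.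
Qed.

Lemma integral_powR_exponential1 x : 0 <= x ->
  (\int[exponential_law (@ltr01 R)]_t (t `^ x)%:E = (Gamma (x + 1))%:E)%E.
Proof.
move=> x0; rewrite -[LHS]fineK ?integral_powR_exponential_fin//; congr EFin.
rewrite /Gamma /Rintegral; congr fine.
rewrite integral_exponential_law//.
rewrite -integral_itv_obnd_cbnd; last first.
  apply/measurable_EFinP; apply: measurable_funTS; apply: measurable_funM => //.
  by apply: measurable_funM => //; exact: measurable_expRN.
apply: eq_integral => t _; rewrite -EFinM; congr EFin.
by rewrite !mul1r addrK mulrC.
Qed.

Lemma Gamma_fact n : Gamma n.+1%:R = n`!%:R :> R.
Proof.
have := integral_powR_exponential1 (ler0n R n).
by rewrite integral_powRn_exponential natr1 => -[<-].
Qed.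

(** On t >= 1 the integrand t^x is at least 1, and this ray has mass exp(-1). *)
Lemma Gamma_gt0 (x : R) : 0 <= x -> 0 < Gamma (x + 1).
Proof.
move=> x0; rewrite -lte_fin -integral_powR_exponential1//.
apply: (@lt_le_trans _ _ (expR (- (1 * 1)))%:E); first by rewrite lte_fin expR_gt0.
rewrite -(exponential_law_bndy ltr01 true ler01) -[X in exponential_law _ X]setIT.
rewrite -integral_indic//; apply: ge0_le_integral => //.
- exact/measurable_EFinP/measurable_indic.
- exact: mpow.
- move=> t _; rewrite lee_fin indicE; case: (boolP (_ \in _)) => [|_]; last exact: powR_ge0.
  rewrite inE/= in_itv/= andbT => t1.
  have <- : 1 `^ x = 1 :> R by rewrite powR1.
  apply: ge0_ler_powR => //; rewrite nnegrE//.
  exact: le_trans t1.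
Qed.

Lemma integral_powR_exponential (v : R) (v0 : 0 < v) (x : R) : 0 <= x ->
  (\int[exponential_law v0]_t (t `^ x)%:E = (Gamma (x + 1) / v `^ x)%:E)%E.
Proof.
move=> x0; rewrite exponential_law_scale//.
have mpv : measurable_fun setT (fun t : R => ((t / v) `^ x)%:E).
  apply/measurable_EFinP; apply: (measurableT_comp (measurable_powR x)).
  exact: measurable_funM.
transitivity (\int[exponential_law (@ltr01 R)]_t ((v `^ x)^-1%:E * (t `^ x)%:E))%E.
  rewrite integral_exponential_law// [RHS]integral_exponential_law//; last 2 first.
  - exact: measurable_funeM.
  - by move=> t; rewrite mule_ge0// lee_fin invr_ge0 powR_ge0.
  apply: eq_integral => t; rewrite inE/= in_itv/= andbT => t0.
  have vi : v^-1 `^ x = (v `^ x)^-1.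
    by rewrite -(powR_inv1 (ltW v0)) -powRrM mulN1r powRN.
  have v_ge0 : 0 <= v^-1 by rewrite invr_ge0 ltW.
  by congr (_ * _)%E; rewrite -EFinM powRM// vi mulrC.
rewrite ge0_integralZl//; [|exact: mpow|by rewrite lee_fin invr_ge0 powR_ge0].
by rewrite integral_powR_exponential1// -EFinM mulrC.
Qed.

End gamma_moments.

(** If g were infinite at t it would be infinite on a whole ray, which has positive mass. Thus
    finiteness at an exponential time gives finiteness at every fixed time. *)
Lemma nondecreasing_exponential_lty {R : realType} (v : R) (v0 : 0 < v) (g : R -> \bar R) (t : R) :
  measurable_fun setT g -> (forall s, 0 <= g s)%E ->
  (forall r s, r <= s -> (g r <= g s)%E) ->
  (\int[exponential_law v0]_s g s < +oo)%E -> (g t < +oo)%E.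
Proof.
move=> mg g0 gnd goo; rewrite ltNge leye_eq; apply/negP => /eqP gt_oo.
move: goo; apply/negP; rewrite -leNgt.
pose a := Num.max 0 t.
have a0 : 0 <= a by rewrite le_max lexx.
have ga s : a <= s -> g s = +oo%E.
  move=> as_; apply/eqP; rewrite -leye_eq -gt_oo; apply: gnd.
  by rewrite (le_trans _ as_)// le_max lexx orbT.
apply: (@le_trans _ _ (\int[exponential_law v0]_(s in `[a, +oo[) g s)%E); last first.
  by apply: ge0_subset_integral.
rewrite (eq_integral (cst +oo%E)); last first.
  by move=> s; rewrite inE/= in_itv/= andbT => /ga.
rewrite integral_cst// [X in (_ * X)%E](_ : _ = (expR (- (v * a)))%:E); last first.
  exact: exponential_law_bndy.
by rewrite mulyr gtr0_sg ?expR_gt0// mul1e.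
Qed.

Section inverse_subordinator_moments.
Context {R : realType} {d} {T : measurableType d} (P : probability T R).
Variables (nu : R) (sigma : R -> T -> R).
Hypothesis nu_gt0 : 0 < nu.
Hypothesis sigmaP : is_stable_subordinator P nu sigma.
Local Notation mu := (@lebesgue_measure R).
Local Notation L := (inverse_process sigma).

Lemma inverse_subordinator_measurable :
  measurable_fun setT (fun z : measurableTypeR R * T => L z.1 z.2).
Proof.
case: sigmaP => msigma _ [sigma_nd _] _ _.
exact: measurable_inverse_process.
Qed.

Lemma inverse_subordinator_measurable1 t : measurable_fun setT (L t).
Proof.
exact: (measurableT_comp inverse_subordinator_measurable (measurable_pair1 (t : measurableTypeR R))).
Qed.

Lemma inverse_subordinator_ge0 t w : 0 <= L t w.
Proof. by case: sigmaP => _ _ [sigma_nd _] _ _; exact: inverse_process_ge0. Qed.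

Lemma measurable_expectation_inverse (f : R -> \bar R) :
  measurable_fun setT f -> (forall s, 0 <= f s)%E ->
  measurable_fun setT (fun t : R => \int[P]_w f (L t w))%E.
Proof.
move=> mf f0.
apply: (measurable_fun_fubini_tonelli_F (fun z : measurableTypeR R * T => f (L z.1 z.2))) => //.
by apply: measurableT_comp => //; exact: inverse_subordinator_measurable.
Qed.

Lemma expectation_inverse_nd (f : R -> \bar R) (s t : R) :
  measurable_fun setT f -> (forall x, 0 <= f x)%E ->
  (forall x y, 0 <= x -> x <= y -> (f x <= f y)%E) -> s <= t ->
  (\int[P]_w f (L s w) <= \int[P]_w f (L t w))%E.
Proof.
move=> mf f0 fnd st; apply: ae_ge0_le_integral => //.
- by apply: measurableT_comp => //; exact: inverse_subordinator_measurable1.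
- by apply: measurableT_comp => //; exact: inverse_subordinator_measurable1.
- apply: filterS (ae_inverse_process_nd sigmaP) => w Lnd _.
  by apply: fnd; [exact: inverse_subordinator_ge0|exact: Lnd].
Qed.

Let mpow (x : R) : measurable_fun setT (fun t : R => (t `^ x)%:E).
Proof. exact/measurable_EFinP. Qed.

Let pow_ge0 x (t : R) : (0 <= (t `^ x)%:E)%E.
Proof. by rewrite lee_fin powR_ge0. Qed.

Let moment (n : nat) (t : R) := (\int[P]_w (L t w `^ n%:R)%:E)%E.

Let moment_ge0 n t : (0 <= moment n t)%E.
Proof. by apply: integral_ge0 => w _; exact: pow_ge0. Qed.

Let measurable_moment n : measurable_fun setT (moment n).
Proof. exact: (measurable_expectation_inverse (mpow n%:R) (pow_ge0 n%:R)). Qed.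

Let moment_nd n s t : s <= t -> (moment n s <= moment n t)%E.
Proof.
apply: (expectation_inverse_nd (mpow n%:R) (pow_ge0 n%:R)) => x y x0 xy; rewrite lee_fin.
by apply: ge0_ler_powR => //; rewrite nnegrE// (le_trans x0).
Qed.

Let moment_exponential n v (v0 : 0 < v) :
  (\int[exponential_law v0]_t moment n t = (n`!%:R / v `^ (nu * n%:R))%:E)%E.
Proof.
rewrite (exponential_time_inverse sigmaP v0 (powR_gt0 nu v0) (mpow _) (pow_ge0 _)).
by rewrite integral_powR_exponential// natr1 Gamma_fact powRrM.
Qed.

Let moment_fin n t : moment n t \is a fin_num.
Proof.
rewrite ge0_fin_numE//.
have goo : (\int[exponential_law (@ltr01 R)]_s moment n s < +oo)%E.
  by rewrite moment_exponential ltry.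
exact: (nondecreasing_exponential_lty t (measurable_moment n) (moment_ge0 n) (@moment_nd n) goo).
Qed.

Let nun_ge0 n : 0 <= nu * n%:R. Proof. by rewrite mulr_ge0// ltW. Qed.

Lemma inverse_subordinator_moment n t : 0 <= t ->
  (\int[P]_w (L t w `^ n%:R)%:E =
   (n`!%:R / Gamma (nu * n%:R + 1) * t `^ (nu * n%:R))%:E)%E.
Proof.
(* Injectivity of the transform says nothing at t = 0. There L_0 = 0 almost surely, and for n = 0
   both sides are 1 because the power 0 to the 0 is 1. *)
rewrite le_eqVlt => /orP[/eqP <-|t0].
  rewrite (ae_eq_integral (cst (0 `^ n%:R)%:E)) => //; last 2 first.
  - by apply: (measurableT_comp (mpow n%:R)); exact: inverse_subordinator_measurable1.
  - by apply: filterS (ae_inverse_process0 nu_gt0 sigmaP) => w -> _.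
  rewrite integral_cst_probability; congr EFin.
  case: n => [|n]; last by rewrite !powR0 ?mulr0// mulf_neq0 ?pnatr_eq0// gt_eqF.
  by rewrite mulr0 add0r !powRr0 (Gamma_fact 0) mulr1 divff// pnatr_eq0.
have [psi psiE] : exists psi : R -> R, forall s, ((psi s)%:E = moment n s)%E.
  by exists (fun s => fine (moment n s)) => s; rewrite fineK.
rewrite -/(moment n t) -psiE; congr EFin; apply/esym.
pose c := n`!%:R / Gamma (nu * n%:R + 1) : R.
have G0 := Gamma_gt0 (nun_ge0 n).
have c0 : 0 <= c by rewrite divr_ge0// ltW.
have mphi : measurable_fun setT (fun t => c * t `^ (nu * n%:R)).
  by apply: measurable_funM.
have lap (v : R) : 0 < v -> 
   (\int[mu]_(t in `[0%R, +oo[) (expR (- (v * t)) * (c * t `^ (nu * n%:R)))%:E =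
    v^-1%:E * (n`!%:R / v `^ (nu * n%:R))%:E)%E.
  move=> v0; under eq_integral do rewrite EFinM.
  rewrite laplace_exponential_law//; last 2 first.
  - exact/measurable_EFinP.
  - by move=> s; rewrite lee_fin mulr_ge0 ?powR_ge0.
  congr (_ * _)%E.
  under eq_integral do rewrite EFinM.
  rewrite ge0_integralZl//; last exact: mpow.
  rewrite integral_powR_exponential// -EFinM; congr EFin.
  by rewrite /c; field; rewrite !gt_eqF ?powR_gt0.
pose phi t := c * t `^ (nu * n%:R).
have mpsi : measurable_fun setT psi.
  apply/measurable_EFinP; apply: eq_measurable_fun (measurable_moment n) => s _.
  by rewrite -psiE.
have phi_ge0 s : 0 <= s -> 0 <= phi s by move=> s0; rewrite mulr_ge0 ?powR_ge0.
have psi_ge0 s : 0 <= s -> 0 <= psi s by move=> _; rewrite -lee_fin psiE.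
have phi_cont s : 0 < s -> {for s, continuous phi}.
  move=> s0; apply: cvgM (cvg_cst _) _.
  have /differentiable_continuous :
      differentiable ((fun x => x `^ (nu * n%:R)) : R^o -> R^o) (s : R^o).
    by apply/derivable1_diffP; apply: derivable_powR; rewrite in_itv/= s0.
  exact.
have psi_nd r s : 0 <= r -> r <= s -> psi r <= psi s.
  by move=> _ rs; rewrite -lee_fin (psiE r) (psiE s); exact: moment_nd.
have lap_eq j : (0 < j)%N ->
    (\int[mu]_(t in `[0%R, +oo[) (expR (- (j%:R * t)) * phi t)%:E =
     \int[mu]_(t in `[0%R, +oo[) (expR (- (j%:R * t)) * psi t)%:E)%E.
  move=> j0; have v0 : 0 < j%:R :> R by rewrite ltr0n.
  rewrite lap//.
  under [RHS]eq_integral do rewrite EFinM psiE.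
  by rewrite (laplace_exponential_law v0)// moment_exponential.
have lap_lty j : (0 < j)%N ->
    (\int[mu]_(t in `[0%R, +oo[) (expR (- (j%:R * t)) * phi t)%:E < +oo)%E.
  by move=> j0; rewrite lap ?ltr0n// -EFinM ltry.
exact: (laplace_injective mphi mpsi phi_ge0 psi_ge0 phi_cont psi_nd lap_eq lap_lty t0).
Qed.

(** With v chosen so that v^nu = 2 b, L at an exponential time of rate v is exponential of rate 2 b,
    and the expectation of e^(b L) is 2. These moments dominate the Mittag-Leffler expansion. *)
Lemma inverse_subordinator_exp_lty b t : 0 < b ->
  (\int[P]_w (expR (b * L t w))%:E < +oo)%E.
Proof.
move=> b0; pose v := (2 * b) `^ nu^-1.
have b20 : 0 < 2 * b by rewrite mulr_gt0.
have v0 : 0 < v by exact: powR_gt0.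
have vnu : v `^ nu = 2 * b by rewrite -powRrM mulVf ?gt_eqF// powRr1// ltW.
have vnu0 : 0 < v `^ nu by rewrite vnu.
have mexp : measurable_fun setT (fun s : R => (expR (b * s))%:E).
  by apply/measurable_EFinP; apply: measurableT_comp => //; exact: measurable_funM.
pose g (t : R) := (\int[P]_w (expR (b * L t w))%:E)%E.
have exp_ge0 (s : R) : (0 <= (expR (b * s))%:E)%E by rewrite lee_fin expR_ge0.
have mg : measurable_fun setT g by exact: (measurable_expectation_inverse mexp exp_ge0).
have g0 s : (0 <= g s)%E by apply: integral_ge0 => w _; exact: exp_ge0.
have gnd r s : r <= s -> (g r <= g s)%E.
  apply: (expectation_inverse_nd mexp exp_ge0) => x y x0 xy.
  by rewrite lee_fin ler_expR ler_pM2l.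
have goo : (\int[exponential_law v0]_s g s = 2%:E)%E.
  rewrite (exponential_time_inverse sigmaP v0 vnu0 mexp exp_ge0).
  rewrite integral_exponential_law// vnu.
  transitivity (\int[mu]_(s in `[0%R, +oo[)
      (2%:E * ((b * expR (- (b * s)))%:E * cst 1%:E s)))%E => /=.
    apply: eq_integral => s _; rewrite -!EFinM; congr EFin.
    by rewrite mulr1 -mulrA -expRD mulrA; congr (_ * expR _); ring.
  rewrite ge0_integralZl//; last 2 first.
  - apply: measurable_funTS; apply: emeasurable_funM => //.
    by apply/measurable_EFinP/measurable_funM => //; exact: measurable_expRN.
  - by move=> s _; rewrite mule1 lee_fin mulr_ge0 ?expR_ge0 ?(ltW b0).
  rewrite -(integral_exponential_law b0)//.
  by rewrite [X in (_ * X)%E](integral_cst_probability (exponential_law b0) 1) mule1.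
by apply: (nondecreasing_exponential_lty t mg g0 gnd (v0 := v0)); rewrite goo ltry.
Qed.

End inverse_subordinator_moments.

Lemma exprn_fact_le_expR {R : realType} (x : R) n : 0 <= x -> x ^+ n / n`!%:R <= expR x.
Proof.
move=> x0; apply: le_trans (series_exp_coeff_le n.+1 x0).
rewrite /series/= big_nat_recr//= -[leLHS]add0r lerD//.
by apply: sumr_ge0 => i _; rewrite divr_ge0// exprn_ge0.
Qed.

(** * Mittag-Leffler functions as expectations *)

Section inverse_subordinator_mittag_leffler.
Context {R : realType} {d} {T : measurableType d} (P : probability T R).
Variables (nu : R) (sigma : R -> T -> R).
Hypothesis nu_gt0 : 0 < nu.
Hypothesis sigmaP : is_stable_subordinator P nu sigma.
Local Notation L := (inverse_process sigma).
Variables (t a : R) (n : nat).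
Hypotheses (t_ge0 : 0 <= t) (a_ge0 : 0 <= a).

Let L_ge0 w : 0 <= L t w. Proof. exact: inverse_subordinator_ge0 sigmaP _ _. Qed.

Let mL : measurable_fun setT (L t).
Proof. exact: inverse_subordinator_measurable1 sigmaP t. Qed.

Let mexp b : measurable_fun setT (fun w => expR (b * L t w)).
Proof. by apply: measurableT_comp => //; exact: measurable_funM. Qed.

Let integrable_exp b : 0 < b -> P.-integrable setT (fun w => (expR (b * L t w))%:E).
Proof.
move=> b0; apply/integrableP; split; first exact/measurable_EFinP.
under eq_integral do rewrite gee0_abs ?lee_fin ?expR_ge0//.
exact: (inverse_subordinator_exp_lty nu_gt0 sigmaP t b0).
Qed.

Let pow_le (m : nat) w : L t w ^+ m <= m`!%:R * expR (L t w).
Proof.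
rewrite -ler_pdivrMl ?ltr0n ?fact_gt0// mulrC.
exact: exprn_fact_le_expR (L_ge0 w).
Qed.

Let integrable_pow (m : nat) : P.-integrable setT (fun w => (L t w ^+ m)%:E).
Proof.
apply: (le_integrable _ _ _ (integrableZl _ m`!%:R (integrable_exp ltr01))) => //.
  by apply/measurable_EFinP; exact: measurable_funX.
move=> w _; rewrite lee_fin !normrM mul1r ger0_norm ?exprn_ge0//.
by rewrite !ger0_norm ?expR_ge0.
Qed.

Let y := t `^ nu.

Let momentE (m : nat) : (\int[P]_w (L t w ^+ m)%:E =
  (m`!%:R / Gamma (nu * m%:R + 1) * y ^+ m)%:E)%E.
Proof.
under eq_integral do rewrite -powR_mulrn//.
by rewrite (inverse_subordinator_moment nu_gt0 sigmaP)// powRrM powR_mulrn// powR_ge0.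
Qed.

Let ml j : R := Gamma (n.+1%:R + j%:R) * (- (a * y)) ^+ j
  / (j`!%:R * Gamma n.+1%:R * Gamma (nu * j%:R + (nu * n%:R + 1))).

Let partial N w := L t w ^+ n * series (exp_coeff (- (a * L t w))) N.

Let integral_partial N : (\int[P]_w (partial N w)%:E =
  (n`!%:R * y ^+ n * series ml N)%:E)%E.
Proof.
transitivity (\int[P]_w (\sum_(0 <= j < N)
    (((- a) ^+ j / j`!%:R)%:E * (L t w ^+ (n + j))%:E)))%E.
  apply: eq_integral => w _; rewrite sumEFin /partial /series/= mulr_sumr.
  congr EFin; apply: eq_bigr => j _.
  by rewrite /exp_coeff/= -mulNr exprMn exprD; ring.
rewrite integral_sum//; last by move=> j; exact: integrableZl.
rewrite /series/= mulr_sumr -sumEFin; apply: eq_bigr => j _.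
rewrite integralZl// momentE -EFinM; congr EFin; rewrite /ml.
rewrite -natrD addSn !Gamma_fact natrD mulrDr.
rewrite (_ : nu * n%:R + nu * j%:R + 1 = nu * j%:R + (nu * n%:R + 1)); last by ring.
rewrite exprD -[- (a * y)]mulNr exprMn.
have G0 : Gamma (nu * j%:R + (nu * n%:R + 1)) != 0 :> R.
  by rewrite addrA gt_eqF// Gamma_gt0// addr_ge0// mulr_ge0// ltW.
field; rewrite G0 !pnatr_eq0 -!lt0n !fact_gt0//.
Qed.

(** The exponential is expanded and each power of L_t is replaced by its moment. The series
    alternates, so the exchange is by dominated convergence: L^n <= n! e^L and the partial sums are
    at most e^(a L), whence the bound n! e^((1 + a) L). *)
Lemma inverse_subordinator_mittag_leffler :
  (\int[P]_w (L t w ^+ n * expR (- (a * L t w)))%:E =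
   (n`!%:R * t `^ (nu * n%:R) *
    mittag_leffler nu (nu * n%:R + 1) n.+1%:R (- (a * t `^ nu)))%:E)%E.
Proof.
have cvgE : (\int[P]_w (partial N w)%:E)%E @[N --> \oo] -->
    (\int[P]_w (L t w ^+ n * expR (- (a * L t w)))%:E)%E.
  pose g w : \bar R := (n`!%:R%:E * (expR ((1 + a) * L t w))%:E)%E.
  apply: (@dominated_cvg _ _ _ P _ _ _ _ g) => //.
  - move=> N; apply/measurable_EFinP; apply: measurable_funM.
      exact: measurable_funX.
    apply: measurable_sum => j; apply: measurable_funM => //; apply: measurable_funX.
    by apply: measurableT_comp => //; exact: measurable_funM.
  - move=> w _; apply/cvg_EFin; first exact: nearW.
    by apply: cvgM (cvg_cst _) _; exact: is_cvg_series_exp_coeff.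
  - apply: integrableZl => //; apply: integrable_exp.
    by rewrite ltr_pwDl.
  - move=> N w _; rewrite /g lee_fin normrM ger0_norm ?exprn_ge0//.
    rewrite mulrDl mul1r expRD mulrA; apply: ler_pM => //; first exact: exprn_ge0.
    apply: le_trans (normr_series_exp_coeff_le _ _) _.
    by rewrite ler_expR normrN ger0_norm// mulr_ge0.
move: cvgE; rewrite (eq_cvg _ _ integral_partial).
set I := (\int[P]_w _)%E => cvgI.
have I_fin : I \is a fin_num.
  apply: integrable_fin_num => //.
  apply: (le_integrable _ _ _ (integrable_pow n)) => //.
    apply/measurable_EFinP; apply: measurable_funM; first exact: measurable_funX.
    by under eq_fun do rewrite -mulNr; exact: mexp.
  move=> w _; rewrite lee_fin normrM ler_piMr// ger0_norm ?expR_ge0//.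
  by rewrite -[leRHS]expR0 ler_expR oppr_le0 mulr_ge0.
rewrite -(fineK I_fin); congr EFin.
have {}cvgI : n`!%:R * y ^+ n * series ml N @[N --> \oo] --> fine I.
  by move: cvgI; rewrite -{1}(fineK I_fin) => /fine_cvg.
rewrite powRrM powR_mulrn ?powR_ge0// -/y.
(* If the prefactor vanishes (t = 0 and n > 0), it cannot be divided out to get the sum of the
   series, but both sides are 0. *)
have [y0|y0] := eqVneq (n`!%:R * y ^+ n) 0.
  rewrite y0 mul0r; move: cvgI; rewrite y0; under eq_fun do rewrite mul0r.
  by move/cvg_lim => <- //; exact: lim_cst.
suff : series ml N @[N --> \oo] --> (n`!%:R * y ^+ n)^-1 * fine I.
  by rewrite /mittag_leffler => /cvg_lim -> //; rewrite mulVKf.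
rewrite (_ : series ml = (fun N => (n`!%:R * y ^+ n)^-1 * (n`!%:R * y ^+ n * series ml N))).
  exact: cvgM (cvg_cst _) _.
by apply/funext => N; rewrite mulKf.
Qed.

End inverse_subordinator_mittag_leffler.

(** * Resolvent equations of a chain with bounded rates *)

Section esum_seq.
Context {R : realType} {E : countType}.

Lemma esum_seqC (s : seq E) (a : E -> \bar R) : uniq s -> (forall l, 0 <= a l)%E ->
  (\esum_(l in [set: E]) a l =
   \sum_(l <- s) a l + \esum_(l in ~` [set` s]) a l)%E.
Proof.
move=> us a0; rewrite (esumID [set` s])// !setTI; congr (_ + _)%E.
rewrite esum_fset; [by rewrite -fsbig_seq|exact: finite_seq|by []].
Qed.

(* Truncating an average of a [0, 1]-valued function to a finite set loses at
   most the mass outside of that set. *)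
Lemma esum_average_bounds (s : seq E) (a b : E -> R) (c : R) : uniq s ->
  (forall l, 0 <= a l) -> (forall l, 0 <= b l <= 1) ->
  (\esum_(l in [set: E]) (a l)%:E = 1)%E ->
  (\esum_(l in [set: E]) (a l * b l)%:E = c%:E)%E ->
  \sum_(l <- s) a l * b l <= c <= \sum_(l <- s) a l * b l + (1 - \sum_(l <- s) a l).
Proof.
move=> us a0 b01 a1 abc.
have ab0 l : (0 <= (a l * b l)%:E)%E.
  by rewrite lee_fin mulr_ge0//; case/andP: (b01 l).
move: abc; rewrite (esum_seqC us ab0) sumEFin => abc.
have a0E l : (0 <= (a l)%:E)%E by rewrite lee_fin.
move: a1; rewrite (esum_seqC us a0E) sumEFin.
move: abc.
have le_ab : (\esum_(l in ~` [set` s]) (a l * b l)%:E <= \esum_(l in ~` [set` s]) (a l)%:E)%E.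
  by apply: le_esum => l _; rewrite lee_fin ler_piMr//; case/andP: (b01 l).
have := esum_ge0 (fun l _ => ab0 l) : (0 <= \esum_(l in ~` [set` s]) (a l * b l)%:E)%E.
move: le_ab.
case: (\esum_(l in ~` [set` s]) (a l * b l)%:E)%E => [x| |];
  case: (\esum_(l in ~` [set` s]) (a l)%:E)%E => [y| |] //.
rewrite !lee_fin => xy x0 [abc] [a1].
by apply/andP; split; lra.
Qed.

End esum_seq.

Lemma cvg_sum_seq {R : realType} {E : eqType} {T : Type} (F : set_system T)
    {FF : Filter F} (s : seq E) (f : T -> E -> R) (a : E -> R) :
  (forall l, l \in s -> f x l @[x --> F] --> a l) ->
  \sum_(l <- s) f x l @[x --> F] --> \sum_(l <- s) a l.
Proof.
elim: s => [_|l s IHs fa].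
  by under eq_fun do rewrite big_nil; rewrite big_nil; exact: cvg_cst.
under eq_fun do rewrite big_cons; rewrite big_cons.
apply: cvgD; first by apply: fa; rewrite mem_head.
by apply: IHs => l' l's; apply: fa; rewrite inE l's orbT.
Qed.

Section bounded_chain.
Context {R : realType} {E : countType}.
Local Notation mu := (@lebesgue_measure R).
Variables (p : R -> E -> E -> R) (q : E -> E -> R) (nbs : E -> seq E).
Hypothesis p_trans : is_transition_function p.
Hypothesis p_rates : has_rates p q.
Hypothesis q_ge0 : forall i j, 0 <= q i j.
Hypothesis uniq_nbs : forall i, uniq (i :: nbs i).
Hypothesis q_nbs : forall i j, j \notin i :: nbs i -> q i j = 0.

Let p_ge0 t i j : 0 <= t -> 0 <= p t i j.
Proof. by case: p_trans => + _ _ _; apply. Qed.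

Let p_sum t i : 0 <= t -> (\esum_(l in [set: E]) (p t i l)%:E = 1)%E.
Proof. by case: p_trans => _ + _ _; apply. Qed.

Let p_0 i j : p 0 i j = (i == j)%:R.
Proof. by case: p_trans. Qed.

Let p_le1 t i j : 0 <= t -> p t i j <= 1.
Proof.
move=> t0; have := p_sum i t0; rewrite (@esum_seqC _ _ [:: j])//; last first.
  by move=> l; rewrite lee_fin p_ge0.
rewrite big_seq1 => pj; rewrite -lee_fin -pj leeDl//.
by apply: esum_ge0 => l _; rewrite lee_fin p_ge0.
Qed.

Let p_bounds s h t i j : uniq s -> 0 <= h -> 0 <= t ->
  \sum_(l <- s) p h i l * p t l j <= p (h + t) i j <=
  \sum_(l <- s) p h i l * p t l j + (1 - \sum_(l <- s) p h i l).
Proof.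
move=> us h0 t0; apply: esum_average_bounds => //.
- by move=> l; exact: p_ge0.
- by move=> l; rewrite p_ge0// p_le1.
- exact: p_sum.
- by case: p_trans => _ _ _ ->.
Qed.

(** Only the event of being in i at time h is kept in the Chapman-Kolmogorov sum. The bound does not
    depend on t, so it gives continuity from both sides. *)
Let p_modulus h t i j : 0 <= h -> 0 <= t ->
  `|p (h + t) i j - p t i j| <= 1 - p h i i.
Proof.
move=> h0 t0; have := @p_bounds [:: i] h t i j isT h0 t0.
rewrite !big_seq1 ler_norml => /andP[l1 l2].
have a0 := p_ge0 i j t0; have a1 := p_le1 i j t0.
have b0 := p_ge0 i i h0; have b1 := p_le1 i i h0.
by apply/andP; split; nra.
Qed.

Definition exit_rate i : R := \sum_(l <- nbs i) q i l.

Let cvg_exit i : (1 - p h i i) / h @[h --> 0^'+] --> exit_rate i.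
Proof.
have [_ /(_ i)] := p_rates.
rewrite (_ : (\esum_(_ in _) _)%E = (exit_rate i)%:E); first by move/fine_cvg.
have /andP[iN uN] := uniq_nbs i.
rewrite esum_mkcond (esum_seqC uN); last by move=> l; case: ifP => // _; rewrite lee_fin.
rewrite esum1 ?adde0; last first.
  move=> l /= /negP lN; case: ifPn => //; rewrite inE/= => li.
  by rewrite q_nbs// inE negb_or li.
rewrite /exit_rate -sumEFin; apply: eq_big_seq => l lN.
rewrite mem_set//=; apply/eqP => li; by move/negP: iN; apply; rewrite -{1}li.
Qed.

Let cvg_rate i l : l \in nbs i -> p h i l / h @[h --> 0^'+] --> q i l.
Proof.
move=> lN; have [+ _] := p_rates; apply.
have /andP[iN _] := uniq_nbs i.
apply/eqP => il; by move/negP: iN; apply; rewrite {1}il.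
Qed.

Variable j : E.

(* The truncation at 0 makes hit continuous on the whole line. *)
Definition hit t i : R := p (Num.max 0 t) i j.

Let hit_ge0 t i : 0 <= hit t i.
Proof. by apply: p_ge0; rewrite le_max lexx. Qed.

Let hit_le1 t i : hit t i <= 1.
Proof. by apply: p_le1; rewrite le_max lexx. Qed.

Let drift i t : R := \sum_(l <- nbs i) q i l * (hit t l - hit t i).

(** Bound, uniform in t, on the error of the backward difference equation: the mass sent outside the
    neighbours, the error on the exit rate and the errors on the rates. *)
Let eps i h : R := ((1 - p h i i) / h - \sum_(l <- nbs i) p h i l / h) +
  `|(1 - p h i i) / h - exit_rate i| + \sum_(l <- nbs i) `|p h i l / h - q i l|.

Let cvg_eps i : eps i h @[h --> 0^'+] --> (0 : R).
Proof.
rewrite [X in _ --> X](_ : 0 = (exit_rate i - exit_rate i) + `|exit_rate i - exit_rate i|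
  + \sum_(l <- nbs i) `|q i l - q i l|); last first.
  by rewrite subrr normr0 !add0r big1// => l _; rewrite subrr normr0.
rewrite /eps; apply: cvgD; first apply: cvgD.
- apply: cvgB; first exact: cvg_exit.
  by apply: cvg_sum_seq => l; exact: cvg_rate.
- by apply: cvg_norm; apply: cvgB; [exact: cvg_exit|exact: cvg_cst].
- apply: cvg_sum_seq => l lN.
  by apply: cvg_norm; apply: cvgB; [exact: cvg_rate|exact: cvg_cst].
Qed.

Let hit_diff i t h : 0 <= t -> 0 < h ->
  `|(hit (h + t) i - hit t i) / h - drift i t| <= eps i h.
Proof.
move=> t0 h0; have ht0 : 0 <= h + t by rewrite addr_ge0// ltW.
rewrite /drift /hit !max_r//.
have := @p_bounds (i :: nbs i) h t i j (uniq_nbs i) (ltW h0) t0.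
rewrite !big_cons.
set S := \sum_(l <- nbs i) p h i l * p t l j; set S1 := \sum_(l <- nbs i) p h i l.
set x := p h i i; set y := p t i j; set z := p (h + t) i j => bnd.
have y0 : 0 <= y by exact: p_ge0.
have y1 : y <= 1 by exact: p_le1.
have -> : \sum_(l <- nbs i) q i l * (p t l j - y) =
    S / h - \sum_(l <- nbs i) (p h i l / h - q i l) * p t l j - exit_rate i * y.
  rewrite /S /exit_rate !mulr_suml -!sumrB; apply: eq_bigr => l _.
  by ring.
have : `|\sum_(l <- nbs i) (p h i l / h - q i l) * p t l j| <=
    \sum_(l <- nbs i) `|p h i l / h - q i l|.
  apply: le_trans (ler_norm_sum _ _ _) _; apply: ler_sum => l _.
  by rewrite normrM ler_piMr// ger0_norm ?p_ge0// p_le1.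
rewrite /eps -mulr_suml -/S1 -/x.
set V := \sum_(l <- nbs i) _; set W := \sum_(l <- nbs i) _ => VW.
(* The three terms of this splitting are bounded by the three terms of [eps], in the same order. *)
have -> : (z - y) / h - (S / h - V - exit_rate i * y) =
    (z - (x * y + S)) / h - ((1 - x) / h - exit_rate i) * y + V.
  by field; rewrite gt_eqF.
apply: le_trans (ler_normD _ _) _; apply: lerD => //.
apply: le_trans (ler_normB _ _) _; apply: lerD.
  rewrite -mulrBl ger0_norm; last by rewrite divr_ge0 ?(ltW h0)// subr_ge0; case/andP: bnd.
  by rewrite ler_pM2r ?invr_gt0//; case/andP: bnd; lra.
by rewrite normrM ler_piMr// ger0_norm.
Qed.

Let cvg_modulus i : 1 - p h i i @[h --> 0^'+] --> (0 : R).
Proof.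
have : (1 - p h i i) / h * h @[h --> 0^'+] --> exit_rate i * (0 : R).
  by apply: cvgM; [exact: cvg_exit|apply: cvg_at_right_filter; exact: cvg_id].
rewrite mulr0; apply: cvg_trans; apply: near_eq_cvg; near=> h.
by rewrite divfK// gt_eqF.
Unshelve. all: by end_near. Qed.

Let hit_continuous i : continuous (hit ^~ i).
Proof.
move=> t; apply/cvgrPdist_lt => e e0.
have /cvgrPdist_lt/(_ _ e0)[d /= d0 dP] := @cvg_modulus i.
have close a b : 0 <= a -> a <= b -> `|a - b| < d -> `|p a i j - p b i j| < e.
  move=> a0; rewrite le_eqVlt => /orP[/eqP -> _|ab abd]; first by rewrite subrr normr0.
  have ba : 0 < b - a by rewrite subr_gt0.
  have := @p_modulus (b - a) a i j (ltW ba) a0; rewrite subrK distrC => /le_lt_trans; apply.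
  have /dP : ball 0 d (b - a) by rewrite /ball/= sub0r opprB.
  move=> /(_ ba); rewrite sub0r normrN ger0_norm// subr_ge0 p_le1//; exact: ltW.
apply/nbhs_ballP; exists d => // s /= ts; rewrite /hit.
have mx : `|Num.max 0 t - Num.max 0 s| < d.
  by move: ts; rewrite /ball/= !ltr_norml => /andP[? ?]; apply/andP;
    case: (leP 0 t) => ?; case: (leP 0 s) => ?; split; lra.
have t'0 : 0 <= Num.max 0 t by rewrite le_max lexx.
have s'0 : 0 <= Num.max 0 s by rewrite le_max lexx.
have [ts'|/ltW ts'] := leP (Num.max 0 t) (Num.max 0 s); first exact: close.
by rewrite distrC; apply: close => //; rewrite distrC.
Qed.

Let drift_continuous i : continuous (drift i).
Proof.
move=> t; apply: cvg_sum_seq => l _; apply: cvgM (cvg_cst _) _.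
by apply: cvgB; exact: hit_continuous.
Qed.

Let hit_derive i (t : R) : 0 < t -> is_derive (t : R^o) 1 (hit ^~ i : R^o -> R^o) (drift i t).
Proof.
move=> t0.
suff cvgd : h^-1 *: ((hit ^~ i : R^o -> R^o) (h *: (1 : R^o) + t) - hit t i) @[h --> 0^'] --> (drift i t : R^o).
  by apply: DeriveDef; [apply/cvg_ex; exists (drift i t : R^o)|exact/cvg_lim].
apply: (@cvg_at_right_left_dnbhs _ R^o).
- apply/cvgrPdist_le => e e0; near=> h.
  have h0 : 0 < h by [].
  rewrite /= scaler1 distrC /GRing.scale/= mulrC.
  apply: le_trans (hit_diff i (ltW t0) h0) _.
  near: h; move/cvgrPdist_le : (@cvg_eps i) => /(_ _ e0).
  apply: filterS => h; rewrite sub0r normrN; apply: le_trans; exact: ler_norm.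
(* For the left derivative (h < 0) the forward estimate is applied from time h + t over the length -
   h; [eps] does not see the change of starting time, and continuity of the drift brings it back to
   t. *)
- apply/cvgrPdist_le => e e0.
  have e20 : 0 < e / 2 by rewrite divr_gt0.
  have /cvgrPdist_le/(_ _ e20)[d /= d0 dP] := @cvg_eps i.
  have /cvgrPdist_le/(_ _ e20)/nbhs_ballP[d2 /= d20 d2P] := @drift_continuous i t.
  near=> h.
  have h0 : 0 < - h by rewrite oppr_gt0.
  have ht0 : 0 <= h + t.
    by rewrite -lerBlDr sub0r; near: h; apply: nbhs_left_ge; rewrite oppr_lt0.
  rewrite /= scaler1 /GRing.scale/=.
  have := hit_diff i ht0 h0; rewrite addKr.
  have : `|0 - eps i (- h)| <= e / 2.
    apply: dP => //; rewrite /= sub0r opprK ltr0_norm -?oppr_gt0//.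
    by rewrite ltrNl; near: h; apply: nbhs_left_gt; rewrite oppr_lt0.
  rewrite sub0r normrN => /(le_trans (ler_norm _)) eps_le /le_trans/(_ eps_le) diff_le.
  have drift_le : `|drift i t - drift i (h + t)| <= e / 2.
    apply: d2P; rewrite /ball/= opprD addrCA subrr addr0 normrN ltr0_norm -?oppr_gt0//.
    by rewrite ltrNl; near: h; apply: nbhs_left_gt; rewrite oppr_lt0.
  rewrite (_ : drift i t - _ = (drift i t - drift i (h + t)) -
      ((hit t i - hit (h + t) i) / - h - drift i (h + t))); last first.
    by field; rewrite lt_eqF// -oppr_gt0.
  apply: le_trans (ler_normB _ _) _.
  by rewrite [leRHS]splitr lerD.
Unshelve. all: by end_near. Qed.

Lemma hit_itv01 t i : 0 <= hit t i <= 1.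
Proof. by rewrite hit_ge0 hit_le1. Qed.

Lemma continuous_hit i : continuous (hit ^~ i).
Proof. exact: hit_continuous. Qed.

Lemma measurable_hit i : measurable_fun setT (hit ^~ i).
Proof. exact: continuous_measurable_fun. Qed.

Definition hit_laplace v i : R :=
  fine (\int[mu]_(t in `[0%R, +oo[) (expR (- (v * t)) * hit t i)%:E)%E.

Section resolvent.
Variables (v : R) (v0 : 0 < v).

Let laplace_bounds (f : R -> R) : measurable_fun setT f ->
  (forall t, 0 <= f t <= 1) ->
  (0 <= \int[mu]_(t in `[0%R, +oo[) (expR (- (v * t)) * f t)%:E <= v^-1%:E)%E.
Proof.
move=> mf f01; have f0 t : (0 <= (f t)%:E)%E by rewrite lee_fin; case/andP: (f01 t).
have mfE : measurable_fun setT (EFin \o f) by exact/measurable_EFinP.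
under eq_integral do rewrite EFinM.
rewrite (laplace_exponential_law v0 mfE f0).
rewrite mule_ge0 ?integral_ge0 ?lee_fin ?invr_ge0 ?(ltW v0)//=.
rewrite -[leRHS]mule1 lee_pmul2l ?lte_fin ?invr_gt0//.
rewrite -(integral_cst_probability (exponential_law v0) 1).
apply: ge0_le_integral => //.
by move=> t _; rewrite lee_fin; case/andP: (f01 t).
Qed.

Let hit01 i t : 0 <= hit t i <= 1. Proof. by rewrite hit_ge0 hit_le1. Qed.

Lemma hit_laplaceE i :
  ((hit_laplace v i)%:E = \int[mu]_(t in `[0%R, +oo[) (expR (- (v * t)) * hit t i)%:E)%E.
Proof.
have /andP[l0 l1] := laplace_bounds (measurable_hit i) (hit01 i).
by rewrite fineK// ge0_fin_numE// (le_lt_trans l1)// ltry.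
Qed.

Lemma hit_laplace_bounds i : 0 <= hit_laplace v i <= v^-1.
Proof.
by have := laplace_bounds (measurable_hit i) (hit01 i); rewrite -hit_laplaceE !lee_fin.
Qed.

Let integral_exp : (\int[mu]_(t in `[0%R, +oo[) (expR (- (v * t)))%:E = v^-1%:E)%E.
Proof.
under eq_integral do rewrite -[(expR _)%:E]mule1.
by rewrite (laplace_exponential_law v0)// integral_cst_probability mule1.
Qed.

Let mE (f : R -> R) : measurable_fun setT f ->
  measurable_fun (`[0%R, +oo[ : set R) (fun t => (expR (- (v * t)) * f t)%:E).
Proof.
move=> mf; apply/measurable_EFinP; apply: measurable_funTS.
by apply: measurable_funM => //; exact: measurable_expRN.
Qed.

(** Writing the rate terms with 1 - [hit] makes all integrands nonnegative, so that integrals may be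
    split without integrability conditions. *)
Let integral_miss i :
  (\int[mu]_(t in `[0%R, +oo[) (expR (- (v * t)) * (1 - hit t i))%:E =
   (v^-1 - hit_laplace v i)%:E)%E.
Proof.
have m1 : measurable_fun setT (fun t => 1 - hit t i).
  by apply: measurable_funB => //; exact: measurable_hit.
have miss01 t : 0 <= 1 - hit t i <= 1.
  by rewrite subr_ge0 hit_le1 gerBl hit_ge0.
have /andP[l0 l1] := laplace_bounds m1 miss01.
rewrite EFinB -integral_exp hit_laplaceE.
under [X in _ = (X - _)%E]eq_integral => t _.
  rewrite (_ : expR (- (v * t)) = expR (- (v * t)) * (1 - hit t i) + expR (- (v * t)) * hit t i).
    by rewrite EFinD; over.
  by rewrite -mulrDr subrK mulr1.
rewrite ge0_integralD//.
- by rewrite addeK// -hit_laplaceE.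
- by move=> t _; rewrite lee_fin mulr_ge0 ?expR_ge0//; case/andP: (miss01 t).
- exact: mE.
- by move=> t _; rewrite lee_fin mulr_ge0 ?expR_ge0.
- by apply: mE; exact: measurable_hit.
Qed.

Let cexp : continuous (fun t : R => expR (- (v * t))).
Proof.
move=> t; apply: continuous_comp; last exact: continuous_expR.
by apply: cvgN; apply: cvgM (cvg_cst _) _; exact: cvg_id.
Qed.

Let exit_ge0 i : 0 <= exit_rate i.
Proof. by apply: sumr_ge0. Qed.

(* Integrate the derivative of - e^(- v t) (hit t i + exit_rate i / v), the
   constant being there to make that derivative nonnegative. *)
Let integral_resolvent i :
  (\int[mu]_(t in `[0%R, +oo[) (expR (- (v * t)) *
    ((v + exit_rate i) * hit t i + \sum_(l <- nbs i) q i l * (1 - hit t l)))%:E =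
   ((i == j)%:R + exit_rate i / v)%:E)%E.
Proof.
pose H (t : R) : R := - (expR (- (v * t)) * (hit t i + exit_rate i / v)).
have dH (t : R) : 0 < t -> is_derive (t : R^o) 1 (H : R^o -> R^o) (expR (- (v * t)) *
    ((v + exit_rate i) * hit t i + \sum_(l <- nbs i) q i l * (1 - hit t l))).
  move=> t0.
  have d1 : is_derive (t : R^o) 1 (fun t : R^o => expR (- (v * t)) : R^o)
      (- (v * expR (- (v * t)))).
    by apply: is_derive_eq; rewrite /GRing.scale/=; ring.
  have d2 : is_derive (t : R^o) 1 (fun t : R^o => hit t i + exit_rate i / v : R^o) (drift i t).
    have := is_deriveD (hit_derive i t0) (is_derive_cst (exit_rate i / v : R^o) (t : R^o) 1).
    by move=> dd; apply: (is_derive_eq dd); rewrite addr0.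
  apply: (is_derive_eq (is_deriveN (is_deriveM d1 d2))).
  rewrite /GRing.scale/= /drift.
  have -> : \sum_(l <- nbs i) q i l * (hit t l - hit t i) =
      \sum_(l <- nbs i) q i l * hit t l - exit_rate i * hit t i.
    by under eq_bigr do rewrite mulrBr; rewrite sumrB -mulr_suml.
  have -> : \sum_(l <- nbs i) q i l * (1 - hit t l) =
      exit_rate i - \sum_(l <- nbs i) q i l * hit t l.
    by under eq_bigr do rewrite mulrBr mulr1; rewrite sumrB.
  by field; rewrite gt_eqF.
rewrite (@ge0_continuous_FTC2y _ _ H _ 0).
- rewrite /H mulr0 oppr0 expR0 mul1r /hit maxxx p_0.
  by rewrite EFinN oppeK add0e.
- move=> t t0; rewrite mulr_ge0 ?expR_ge0// addr_ge0//.
    by rewrite mulr_ge0 ?hit_ge0// addr_ge0// ltW.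
  by apply: sumr_ge0 => l _; rewrite mulr_ge0// subr_ge0.
- apply: continuous_subspaceT => t; apply: cvgM; first exact: cexp.
  apply: cvgD; first by apply: cvgM (cvg_cst _) _; exact: hit_continuous.
  apply: cvg_sum_seq => l _; apply: cvgM (cvg_cst _) _.
  by apply: cvgB; [exact: cvg_cst|exact: hit_continuous].
- rewrite -oppr0; apply: cvgN.
  apply: (@squeeze_cvgr _ _ _ _ (cst 0) (fun t => expR (- (v * t)) * (1 + exit_rate i / v))).
  + apply: nearW => t; rewrite mulr_ge0 ?expR_ge0//=; last first.
      by rewrite addr_ge0 ?hit_ge0// divr_ge0// ltW.
    by rewrite ler_wpM2l ?expR_ge0// lerD2r.
  + exact: cvg_cst.
  + rewrite -(mul0r (1 + exit_rate i / v)); apply: cvgM (cvg_cst _).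
    exact: cvg_expRNM.
- by move=> t /dH [].
- apply: cvg_at_right_filter; apply: cvgN; apply: cvgM; first exact: cexp.
  by apply: cvgD; [exact: hit_continuous|exact: cvg_cst].
- move=> t; rewrite in_itv/= andbT => /dH dHt.
  by rewrite derive1E (@derive_val _ _ _ _ _ _ _ dHt).
Qed.

(** The Laplace transform of the backward equation; the constants [exit_rate i / v] added for
    nonnegativity cancel. *)
Lemma hit_laplace_resolvent i :
  (v + exit_rate i) * hit_laplace v i =
  (i == j)%:R + \sum_(l <- nbs i) q i l * hit_laplace v l.
Proof.
have := integral_resolvent i.
under eq_integral => t _.
  rewrite mulrDr mulrCA mulr_sumr EFinD EFinM -sumEFin.
  under eq_bigr do rewrite mulrCA EFinM.
  over.
have miss_ge0 t l : (0 <= (expR (- (v * t)) * (1 - hit t l))%:E)%E.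
  by rewrite lee_fin mulr_ge0 ?expR_ge0// subr_ge0.
have mmiss l : measurable_fun (`[0%R, +oo[ : set R) (fun t => (expR (- (v * t)) * (1 - hit t l))%:E).
  by apply: mE; apply: measurable_funB => //; exact: measurable_hit.
have hit_exp_ge0 t : (0 <= (expR (- (v * t)) * hit t i)%:E)%E.
  by rewrite lee_fin mulr_ge0 ?expR_ge0.
have ve0 : (0 <= (v + exit_rate i)%:E)%E by rewrite lee_fin addr_ge0// ltW.
rewrite ge0_integralD//; last 4 first.
- by move=> t _; rewrite mule_ge0.
- by apply: measurable_funeM; apply: mE; exact: measurable_hit.
- by move=> t _; apply: sume_ge0 => l _; rewrite mule_ge0// lee_fin.
- by apply: emeasurable_sum => l; apply: measurable_funeM; exact: mmiss.
rewrite ge0_integralZl//; last by apply: mE; exact: measurable_hit.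
rewrite ge0_integral_sum//; last 2 first.
- by move=> l; apply: measurable_funeM; exact: mmiss.
- by move=> l t _; rewrite mule_ge0// lee_fin.
rewrite (eq_bigr (fun l => (q i l * (v^-1 - hit_laplace v l))%:E)); last first.
  move=> l _; rewrite ge0_integralZl//; [|exact: mmiss|by rewrite lee_fin].
  by rewrite integral_miss -EFinM.
rewrite sumEFin -hit_laplaceE -EFinM -EFinD => -[].
under eq_bigr do rewrite mulrBr.
rewrite sumrB -mulr_suml -/(exit_rate i).
move=> E1; lra.
Qed.

End resolvent.

End bounded_chain.

(** * The classical queue *)

Section queue_states.
Variable k : nat.
Hypothesis k_gt0 : (0 < k)%N.

Definition up_state (x : state k) : state k :=
  insubd (empty_state k)
    (let: (n, s) := val x in if n == 0%N then (1%N, k) else (n.+1, s)).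

Definition down_state (x : state k) : state k :=
  insubd (empty_state k)
    (let: (n, s) := val x in
     if (2 <= s)%N then (n, s.-1) else if (2 <= n)%N then (n.-1, k) else (0, 0)%N).

Definition queue_nbs (x : state k) : seq (state k) :=
  if x == empty_state k then [:: up_state x] else [:: up_state x; down_state x].

(* Number of phases of service still to be completed. *)
Definition phases (x : state k) : nat := let: (n, s) := val x in (k * n.-1 + s)%N.

Lemma phases_empty : phases (empty_state k) = 0%N.
Proof. by rewrite /phases/= muln0. Qed.

Lemma stateP (x : state k) : x != empty_state k ->
  [/\ 1 <= (val x).1, 1 <= (val x).2 & (val x).2 <= k]%N.
Proof.
move=> x0; have := valP x; rewrite /in_states => /orP[/eqP E|/and3P[]//].
by move: x0; rewrite (_ : x = empty_state k) ?eqxx//; apply: val_inj.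
Qed.

Lemma val_up_state (x : state k) :
  val (up_state x) = (if x == empty_state k then (1%N, k) else ((val x).1.+1, (val x).2)).
Proof.
have [->|x0] := eqVneq x (empty_state k); first by rewrite val_insubd/= /in_states/= leqnn k_gt0.
have := stateP x0; rewrite /up_state; case: (val x) => n s /= [n1 s1 sk].
by rewrite val_insubd gtn_eqF// /in_states/= s1 sk.
Qed.

Lemma val_down_state (x : state k) : x != empty_state k ->
  val (down_state x) = (let: (n, s) := val x in
     if (2 <= s)%N then (n, s.-1) else if (2 <= n)%N then (n.-1, k) else (0, 0)%N).
Proof.
move=> x0; have := stateP x0; rewrite /down_state; case: (val x) => n s /= [n1 s1 sk].
rewrite val_insubd; case: ifP => //; rewrite /in_states => /negbT.
by case: ifP => s2; [|case: ifP => n2]; rewrite !xpair_eqE/=; lia.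
Qed.

Lemma phases_up x : phases (up_state x) = (phases x + k)%N.
Proof.
rewrite /phases val_up_state; have [->|x0] := eqVneq x (empty_state k); first by rewrite /= !muln0.
by have := stateP x0; case: (val x) => n s /= [n1 s1 sk]; nia.
Qed.

Lemma phases_gt0 x : x != empty_state k -> (0 < phases x)%N.
Proof.
move=> x0; have := stateP x0; rewrite /phases; case: (val x) => n s /= [_ s1 _].
by rewrite addn_gt0 s1 orbT.
Qed.

Lemma phases_down x : x != empty_state k -> phases (down_state x) = (phases x).-1.
Proof.
move=> x0; rewrite /phases val_down_state//.
have := stateP x0; case: (val x) => n s /= [n1 s1 sk].
have s1E : ~~ (2 <= s)%N -> s = 1%N by lia.
case: ifP => s2; first by rewrite -!subn1 addnBA.
rewrite s1E ?s2//; case: ifP => n2 /=; last by rewrite (_ : n = 1%N) ?muln0//; lia.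
by case: n n1 n2 => [|[|n]]//= _ _; rewrite mulnS addn1 addnC.
Qed.

Lemma uniq_queue_nbs x : uniq (x :: queue_nbs x).
Proof.
rewrite /queue_nbs; have [->|x0] := eqVneq x (empty_state k).
  rewrite /= !inE andbT; apply/eqP => /(congr1 val); rewrite val_up_state eqxx.
  by case.
have := stateP x0; have := val_up_state x; have := val_down_state x0.
rewrite (negPf x0) /= !inE negb_or !andbT -!(inj_eq val_inj)/= => -> ->.
case: (val x) => n s /= [n1 s1 sk].
by case: ifP => s2; [|case: ifP => n2]; rewrite !xpair_eqE/=; lia.
Qed.

Section rates.
Context {R : realType}.
Variables (lambda mu : R).
Hypotheses (lambda_gt0 : 0 < lambda) (mu_gt0 : 0 < mu).
Local Notation rate := (@MEk1_rate R lambda mu k).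

Lemma rate_up x : rate x (up_state x) = lambda.
Proof.
rewrite /MEk1_rate /pair_rate val_up_state.
have [->|x0] := eqVneq x (empty_state k); first by rewrite /= eqxx.
have := stateP x0; case: (val x) => n s /= [n1 s1 sk].
by rewrite xpair_eqE gtn_eqF//= eqxx.
Qed.

Lemma rate_down x : x != empty_state k -> rate x (down_state x) = k%:R * mu.
Proof.
move=> x0; rewrite /MEk1_rate /pair_rate val_down_state//.
have := stateP x0; case: (val x) => n s /= [n1 s1 sk].
rewrite [X in if X then _ else _]xpair_eqE (gtn_eqF n1)/=.
case: (ltnP 1 s) => s2; first by rewrite !xpair_eqE (ltn_eqF (ltnSn n)) !eqxx.
have -> : s = 1%N by lia.
case: (ltnP 1 n) => n2.
  by rewrite !xpair_eqE (ltn_eqF (_ : n.-1 < n.+1)%N) ?eqxx//=; lia.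
have -> : n = 1%N by lia.
by rewrite !xpair_eqE.
Qed.

Lemma rate_ge0 x y : 0 <= rate x y.
Proof.
have km0 : 0 <= k%:R * mu by rewrite mulr_ge0// ltW.
rewrite /MEk1_rate /pair_rate; case: (val x) => n s.
by repeat case: ifP => _ //; exact: ltW.
Qed.

Lemma rate_nbs x y : y \notin x :: queue_nbs x -> rate x y = 0.
Proof.
rewrite /queue_nbs; have [->|x0] := eqVneq x (empty_state k).
  rewrite !inE -!(inj_eq val_inj) val_up_state eqxx /= negb_or => /andP[_ y1].
  by rewrite /MEk1_rate /pair_rate /= (negPf y1).
rewrite !inE -!(inj_eq val_inj) val_up_state (negPf x0) val_down_state//.
rewrite /MEk1_rate /pair_rate.
have := stateP x0; case: (val x) => n s /= [n1 s1 sk].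
case: (val y) => n' s'.
rewrite !negb_or => /and3P[_ yup ydn].
rewrite [X in if X then _ else _]xpair_eqE gtn_eqF//= (negPf yup).
move: ydn; case: (ltnP 1 s) => s2 /= ydn.
  by rewrite (negPf ydn) (gtn_eqF s2) /= xpair_eqE (gtn_eqF s2) andbF.
have s1E : s = 1%N by lia.
rewrite s1E eqxx /=; move: ydn; case: (ltnP 1 n) => n2 ydn.
  by rewrite (negPf ydn) /= xpair_eqE (gtn_eqF n2).
by rewrite /= (negPf ydn) andbF.
Qed.

End rates.

End queue_states.

(** * Resolvent of the classical queue at the empty state *)

Section queue_laplace.
Context {R : realType}.
Variables (lambda mu : R) (k : nat) (p : R -> state k -> state k -> R).
Hypotheses (lambda_gt0 : 0 < lambda) (mu_gt0 : 0 < mu) (k_gt0 : (0 < k)%N).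
Hypothesis p_trans : is_transition_function p.
Hypothesis p_rates : has_rates p (@MEk1_rate R lambda mu k).
Variables (v : R) (v0 : 0 < v).

Let a := lambda + k%:R * mu.
Let A := lambda / (a + v).
Let B := k%:R * mu / (a + v).
Let empty := empty_state k.
Let hl := hit_laplace p empty v.

Let kmu_gt0 : 0 < k%:R * mu. Proof. by rewrite mulr_gt0// ltr0n. Qed.
Let av_gt0 : 0 < a + v. Proof. by rewrite !addr_gt0. Qed.
Let A_ge0 : 0 <= A. Proof. by rewrite divr_ge0 ?ltW. Qed.
Let B_ge0 : 0 <= B. Proof. by rewrite divr_ge0 ?ltW. Qed.
Let AB_lt1 : A + B < 1.
Proof. by rewrite -mulrDl ltr_pdivrMr// mul1r ltrDl. Qed.

Let hl01 i : 0 <= hl i <= v^-1.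
Proof.
apply: (hit_laplace_bounds p_trans p_rates) => //.
- by move=> *; exact: rate_ge0.
- by move=> *; exact: (uniq_queue_nbs k_gt0).
- by move=> *; exact: (rate_nbs k_gt0).
Qed.

Let resolvent i : (v + exit_rate (@MEk1_rate R lambda mu k) (@queue_nbs k) i) * hl i =
  (i == empty)%:R + \sum_(l <- queue_nbs i) @MEk1_rate R lambda mu k i l * hl l.
Proof.
apply: (hit_laplace_resolvent p_trans p_rates) => //.
- by move=> *; exact: rate_ge0.
- by move=> *; exact: uniq_queue_nbs.
- by move=> *; exact: rate_nbs.
Qed.

Let resolvent_empty : (v + lambda) * hl empty = 1 + lambda * hl (up_state empty).
Proof.
by have := resolvent empty; rewrite /exit_rate /queue_nbs eqxx !big_seq1 rate_up.
Qed.

Let resolvent_busy i : i != empty ->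
  hl i = A * hl (up_state i) + B * hl (down_state i).
Proof.
move=> i0; have := resolvent i.
rewrite /exit_rate /queue_nbs (negPf i0) !big_cons !big_nil rate_up// rate_down//.
rewrite !addr0 add0r (addrC v) -/a => E.
apply: (mulfI (lt0r_neq0 av_gt0)).
rewrite E /A /B; field; exact: lt0r_neq0.
Qed.

(** This is the strong Markov property at the first emptying, obtained by uniqueness instead: both
    sides are bounded, agree at the empty state and solve the same contracting recursion at busy
    states. *)
Lemma queue_hit_laplace i : hl i = passage k A B (phases i) * hl empty.
Proof.
apply/eqP; rewrite -subr_eq0; apply/eqP.
pose f i := hl i - passage k A B (phases i) * hl empty.
have p0 := passage_ge0 k A_ge0 B_ge0 AB_lt1; have p1 := passage_le1 k A_ge0 B_ge0 AB_lt1.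
apply: (@bounded_contraction_eq0 R _ f v^-1 (A + B)) => //; first exact: addr_ge0.
  move=> l; have /andP[h0 h1] := hl01 l; have /andP[e0 e1] := hl01 empty.
  have pe0 := mulr_ge0 (p0 (phases l)) e0.
  have pe1 : passage k A B (phases l) * hl empty <= v^-1.
    by apply: le_trans e1; rewrite ler_piMl.
  by rewrite /f ler_norml; apply/andP; split; lra.
move=> K fK {}i; have [->|i0] := eqVneq i empty.
  rewrite /f phases_empty passage0 mul1r subrr normr0 mulr_ge0 ?addr_ge0//.
  exact: le_trans (normr_ge0 _) (fK empty).
have -> : f i = A * f (up_state i) + B * f (down_state i).
  rewrite /f (resolvent_busy i0) phases_up// phases_down//.
  have := phases_gt0 i0; case: (phases i) => // m _.
  by rewrite passage_rec//=; ring.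
rewrite mulrDl; apply: (le_trans (ler_normD _ _)).
by rewrite (normrM A) (normrM B) (ger0_norm A_ge0) (ger0_norm B_ge0) lerD// ler_wpM2l.
Qed.

Lemma queue_hit_laplace_empty :
  hl empty = (k%:R * mu)^-1 * (passage k A B 1 / (1 - passage k A B 1)).
Proof.
pose z := passage k A B 1; rewrite -/z.
have z1 : 1 - z != 0 by rewrite subr_eq0 gt_eqF// passage1_lt1.
have zE : z = B + A * z ^+ k.+1.
  by rewrite /z {1}passage_rec// passage0 mulr1 passageE// add1n.
have zE' : (a + v) * z = k%:R * mu + lambda * (z ^+ k * z).
  by rewrite {1}zE -exprSr /A /B; field; exact: lt0r_neq0.
have := resolvent_empty.
rewrite [hl (up_state _)]queue_hit_laplace phases_up// phases_empty add0n passageE// -/z => E.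
apply: (mulfI (lt0r_neq0 kmu_gt0)); rewrite mulVKf ?lt0r_neq0//.
apply: (mulIf z1); rewrite divfK//.
(* Substituted for the first [k%:R * mu] only, this turns k mu (1 - z) [hl empty] into z times ((v +
   lambda) - lambda z^k) [hl empty], and the second factor is 1 by the resolvent equation at the
   empty state. *)
have kE : k%:R * mu = (a + v) * z - lambda * (z ^+ k * z) by rewrite zE'; ring.
transitivity (z * ((v + lambda) * hl empty - lambda * (z ^+ k * hl empty))); last first.
  by rewrite E addrK mulr1.
transitivity ((k%:R * mu - k%:R * mu * z) * hl empty); first by ring.
rewrite {1}kE /a; ring.
Qed.

End queue_laplace.

(** * Double series with nonnegative terms *)

Lemma nneseries_EFin_cvg {R : realType} (u : R^nat) (l : R) :
  series u n @[n --> \oo] --> l -> (\sum_(i <oo) (u i)%:E = l%:E)%E.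
Proof.
move=> ul; apply/cvg_lim => //; under eq_fun do rewrite sumEFin.
by apply/cvg_EFin; [exact: nearW|exact: ul].
Qed.

Lemma nneseries_EFin_limn {R : realType} (u : R^nat) (l : R) :
  (forall i, 0 <= u i) -> (\sum_(i <oo) (u i)%:E <= l%:E)%E ->
  cvgn (series u) /\ (\sum_(i <oo) (u i)%:E = (limn (series u))%:E)%E.
Proof.
move=> u0 ul; have cu : cvgn (series u).
  apply: nondecreasing_is_cvgn; first exact: nondecreasing_series.
  exists l => _ [n _ <-]; rewrite -lee_fin -sumEFin; apply: le_trans ul.
  by apply: nneseries_lim_ge => i _ _; rewrite lee_fin.
by split => //; exact: nneseries_EFin_cvg.
Qed.

(** Sums and integrals are exchanged in the extended reals; the finite total then forces every inner
    series to converge, which brings the identity back to the reals. The shift [m.+1] accounts for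
    the sum starting at m = 1. *)
Lemma double_series_sum_nneseries {R : realType} (a : nat -> nat -> R) (l : R) :
  (forall m r, 0 <= a m.+1 r) ->
  (\sum_(m <oo) \sum_(r <oo) (a m.+1 r)%:E = l%:E)%E -> double_series_sum a l.
Proof.
move=> a0 al.
have S0 m : (0 <= \sum_(r <oo) (a m.+1 r)%:E)%E.
  by apply: nneseries_ge0 => r _ _; rewrite lee_fin.
have Sl m : (\sum_(r <oo) (a m.+1 r)%:E <= l%:E)%E.
  rewrite -al; apply: (@le_trans _ _ (\sum_(0 <= i < m.+1) \sum_(r <oo) (a i.+1 r)%:E)%E).
    by rewrite big_nat_recr//= leeDr// sume_ge0.
  by apply: nneseries_lim_ge.
have SE m := nneseries_EFin_limn (a0 m) (Sl m).
split=> [[//|m] _|]; first by have [] := SE m.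
rewrite -cvg_shiftS/=; under eq_fun do rewrite big_add1/=.
suff /fine_cvg : (\sum_(0 <= m < M) limn (series (a m.+1)))%:E @[M --> \oo] --> l%:E by [].
rewrite -al; under eq_fun do rewrite -sumEFin.
rewrite (eq_eseriesr (fun m _ => (SE m).2)).
apply: is_cvg_nneseries => m _ _; rewrite -(SE _).2; exact: S0.
Qed.

Section queue_transition.
Context {R : realType}.
Variables (lambda mu : R) (k : nat) (p : R -> state k -> state k -> R).
Hypotheses (lambda_gt0 : 0 < lambda) (mu_gt0 : 0 < mu) (k_gt0 : (0 < k)%N).
Hypothesis p_trans : is_transition_function p.
Hypothesis p_rates : has_rates p (@MEk1_rate R lambda mu k).

Local Notation a := (lambda + k%:R * mu).
Local Notation empty := (empty_state k).
Local Notation delta := (delta0 k).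

Let kmu_gt0 : 0 < k%:R * mu. Proof. by rewrite mulr_gt0// ltr0n. Qed.
Let a_gt0 : 0 < a. Proof. exact: addr_gt0. Qed.

Lemma C0_ge0 m r : 0 <= C0 lambda mu k m r.
Proof. by rewrite C0_ballot !mulr_ge0 ?exprn_ge0 ?ballot_ge0// ltW. Qed.

(** The exponent [delta] is the total number of steps, r up and m + 1 + r k down, so the denominator
    spreads over the step weights; one factor k mu is missing from [C0]. *)
Lemma C0_laplace_passage v m r : 0 < v ->
  C0 lambda mu k m.+1 r / (a + v) ^+ delta m.+1 r =
  (k%:R * mu)^-1 * (ballot k m.+1 r * (lambda / (a + v)) ^+ r
                     * (k%:R * mu / (a + v)) ^+ (m.+1 + r * k)).
Proof.
move=> v0; have av : a + v != 0 by rewrite lt0r_neq0// addr_gt0.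
rewrite C0_ballot /delta0 (_ : m.+1 + r * k.+1 = r + (m.+1 + r * k))%N; last by lia.
rewrite addSn subn1/= (exprD (a + v)) 2!expr_div_n (exprS (k%:R * mu)).
have := expf_neq0 (m + r * k).+1 av; have := expf_neq0 r av; have := lt0r_neq0 kmu_gt0.
move: (k%:R * mu) ((a + v) ^+ r) ((a + v) ^+ _) ((k%:R * mu) ^+ _) (lambda ^+ r) => u x y z t.
by move=> u0 x0 y0; field; rewrite x0 y0.
Qed.

(** The inner sum over r is a passage weight, hence z^(m+1) / (k mu); the outer one is geometric of
    ratio z < 1. *)
Lemma C0_laplace v : 0 < v ->
  (\sum_(m <oo) \sum_(r <oo) (C0 lambda mu k m.+1 r / (a + v) ^+ delta m.+1 r)%:E =
   (hit_laplace p empty v empty)%:E)%E.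
Proof.
move=> v0; have av : 0 < a + v by rewrite addr_gt0.
pose A := lambda / (a + v); pose B := k%:R * mu / (a + v).
have A0 : 0 <= A by rewrite divr_ge0 ?ltW.
have B0 : 0 <= B by rewrite divr_ge0 ?ltW.
have AB : A + B < 1 by rewrite -mulrDl ltr_pdivrMr// mul1r ltrDl.
have inner m : (\sum_(r <oo) (C0 lambda mu k m.+1 r / (a + v) ^+ delta m.+1 r)%:E =
    ((k%:R * mu)^-1 * passage k A B 1 * passage k A B 1 ^+ m)%:E)%E.
  rewrite -mulrA -exprS -passageE//; apply: nneseries_EFin_cvg.
  rewrite (_ : series _ = fun n => (k%:R * mu)^-1 * passage_sum k A B m.+1 n).
    apply: cvgM (cvg_cst _) _; exact: is_cvg_passage_sum.
  apply/funext => n; rewrite /passage_sum /series/= mulr_sumr.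
  by apply: eq_bigr => r _; rewrite C0_laplace_passage.
rewrite (eq_eseriesr (fun m _ => inner m)).
rewrite (@queue_hit_laplace_empty _ lambda mu)// -/A -/B mulrA.
apply: nneseries_EFin_cvg; apply: cvg_geometric_series.
by rewrite ger0_norm ?passage_ge0// passage1_lt1.
Qed.

End queue_transition.

(** * Laplace inversion of power series with an exponential factor *)

Lemma integral_exprn_exponential {R : realType} (v : R) (v0 : 0 < v) n :
  (\int[exponential_law v0]_t ((Num.max 0 t) ^+ n)%:E = (n`!%:R / v ^+ n)%:E)%E.
Proof.
have mM : measurable_fun setT (fun t : R => ((Num.max 0 t) ^+ n)%:E).
  by apply/measurable_EFinP/measurable_funX/measurable_maxr.
have -> : (n`!%:R / v ^+ n)%:E = (\int[exponential_law v0]_t (t `^ n%:R)%:E)%E.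
  by rewrite integral_powR_exponential// natr1 Gamma_fact powR_mulrn// ltW.
have mP : measurable_fun setT (fun t : R => (t `^ n%:R)%:E).
  by apply/measurable_EFinP; exact: measurable_powR.
have M0 (t : R) : (0 <= ((Num.max 0 t) ^+ n)%:E)%E by rewrite lee_fin exprn_ge0// le_max lexx.
have P0 (t : R) : (0 <= (t `^ n%:R)%:E)%E by rewrite lee_fin powR_ge0.
rewrite (integral_exponential_law v0 mM M0) (integral_exponential_law v0 mP P0).
apply: eq_integral => t; rewrite inE/= in_itv/= andbT => t0.
by rewrite max_r// powR_mulrn.
Qed.

Section power_series_inversion.
Context {R : realType}.
Local Notation mu := (@lebesgue_measure R).
Variables (c : nat -> nat -> R) (n : nat -> nat -> nat) (h : R -> R) (a : R).
Hypothesis a_gt0 : 0 < a.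
Hypothesis c_ge0 : forall m r, 0 <= c m r.
Hypothesis h_ge0 : forall t, 0 <= h t.
Hypothesis h_cont : continuous h.
Hypothesis h_laplace : forall v, 0 < v ->
  (\sum_(m <oo) \sum_(r <oo) (c m r / (a + v) ^+ (n m r).+1)%:E =
   \int[mu]_(t in `[0%R, +oo[) (expR (- (v * t)) * h t)%:E)%E.
Hypothesis h_laplace_lty : forall v, 0 < v ->
  (\int[mu]_(t in `[0%R, +oo[) (expR (- (v * t)) * h t)%:E < +oo)%E.
Hypothesis n00 : n 0 0 = 0%N.
Hypothesis c00 : h 0 <= c 0 0.

(** The truncation at 0 makes the terms nonnegative and nondecreasing on the whole line. *)
Let term m r (s : R) := c m r / (n m r)`!%:R * Num.max 0 s ^+ n m r.

Let max_ge0 (s : R) : 0 <= Num.max 0 s.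
Proof. by rewrite le_max lexx. Qed.

Let term_ge0 m r s : 0 <= term m r s.
Proof. by rewrite mulr_ge0 ?exprn_ge0// divr_ge0. Qed.

Let mterm m r : measurable_fun setT (fun s => (term m r s)%:E).
Proof. by apply/measurable_EFinP/measurable_funM => //; apply/measurable_funX/measurable_maxr. Qed.

Let inner_ge0 m s : (0 <= \sum_(r <oo) (term m r s)%:E)%E.
Proof. by apply: nneseries_ge0 => r _ _; rewrite lee_fin. Qed.

Let psiE s := (\sum_(m <oo) \sum_(r <oo) (term m r s)%:E)%E.

Let psiE_ge0 s : (0 <= psiE s)%E.
Proof. exact: nneseries_ge0. Qed.

Let minner m : measurable_fun setT (fun s => \sum_(r <oo) (term m r s)%:E)%E.
Proof. by apply: ge0_emeasurable_sum => // r s _ _; rewrite lee_fin. Qed.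

Let mpsiE : measurable_fun setT psiE.
Proof. by apply: ge0_emeasurable_sum. Qed.

Let psiE_nd s t : s <= t -> (psiE s <= psiE t)%E.
Proof.
move=> st; apply: lee_nneseries => // m _.
apply: lee_nneseries => [r _ _|r _]; rewrite lee_fin // /term ler_wpM2l ?divr_ge0//.
by rewrite lerXn2r ?nnegrE// ge_max !le_max lexx st orbT.
Qed.

Let psiE_laplace v : a < v ->
  (\int[mu]_(t in `[0%R, +oo[) ((expR (- (v * t)))%:E * psiE t) =
   \int[mu]_(t in `[0%R, +oo[) (expR (- ((v - a) * t)) * h t)%:E)%E.
Proof.
move=> av; have v0 : 0 < v := lt_trans a_gt0 av.
rewrite (laplace_exponential_law v0 mpsiE psiE_ge0) -h_laplace ?subr_gt0// subrKC.
rewrite /psiE integral_nneseries// -nneseriesZl//; last by move=> *; exact: integral_ge0.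
apply: eq_eseriesr => m _.
rewrite integral_nneseries//; [|by move=> *; exact: mterm|by move=> *; rewrite lee_fin].
rewrite -nneseriesZl//; last by move=> *; apply: integral_ge0 => *; rewrite lee_fin.
apply: eq_eseriesr => r _; rewrite /term.
under eq_integral do rewrite EFinM.
rewrite ge0_integralZl_EFin//; [|by move=> *; rewrite lee_fin exprn_ge0| |by rewrite divr_ge0]; last first.
  by apply/measurable_EFinP/measurable_funX/measurable_maxr.
rewrite integral_exprn_exponential -!EFinM exprS; congr _%:E.
have := lt0r_neq0 v0; have : (n m r)`!%:R != 0 :> R by rewrite pnatr_eq0 -lt0n fact_gt0.
by move=> f0 v00; field; rewrite ?expf_neq0 ?f0 ?v00.
Qed.

Let psiE_lty s : (psiE s < +oo)%E.
Proof.
(* Since s^n / n! <= e^(w s) / w^n, the series at s is at most w e^(w s) times the sum of the c /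
   w^(n+1), which is the transform of [h] at 1. *)
pose w := a + 1; have w0 : 0 < w by rewrite addr_gt0.
pose K := w * expR (w * Num.max 0 s); have K0 : 0 <= K by rewrite mulr_ge0 ?expR_ge0// ltW.
have cw0 m r : (0 <= (c m r / w ^+ (n m r).+1)%:E)%E by rewrite lee_fin divr_ge0// exprn_ge0// ltW.
apply: (@le_lt_trans _ _ (K%:E * \sum_(m <oo) \sum_(r <oo) (c m r / w ^+ (n m r).+1)%:E)%E).
  rewrite -nneseriesZl; last by move=> m _; exact: nneseries_ge0.
  apply: lee_nneseries => // m _; rewrite -nneseriesZl//.
  apply: lee_nneseries => [r _ _|r _]; first by rewrite lee_fin.
  rewrite -EFinM lee_fin /term /K exprS.
  have wn0 : 0 < w ^+ n m r by rewrite exprn_gt0.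
  rewrite (_ : w * _ * _ = c m r * (expR (w * Num.max 0 s) / w ^+ n m r)); last first.
    by field; rewrite !lt0r_neq0.
  rewrite -mulrA ler_wpM2l// ler_pdivlMr//.
  apply: le_trans (exprn_fact_le_expR (n m r) (mulr_ge0 (ltW w0) (max_ge0 s))).
  rewrite (_ : _ * _ * _ = (w * Num.max 0 s) ^+ n m r / (n m r)`!%:R)//.
  by rewrite exprMn; ring.
rewrite h_laplace// lte_mul_pinfty//; exact: h_laplace_lty.
Qed.

(** Multiplying by e^(a s) moves the exponential to the continuous side [phi] and leaves the
    monotone power series [psi]; their transforms agree at v > a, where both equal that of [h] at v
    - a. *)
Lemma power_series_laplace_inversion s : 0 <= s ->
  (\sum_(m <oo) \sum_(r <oo) (c m r * (s ^+ n m r / (n m r)`!%:R) * expR (- (a * s)))%:E =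
   (h s)%:E)%E.
Proof.
have [psi psiK] : exists psi : R -> R, forall s, psiE s = (psi s)%:E.
  by exists (fine \o psiE) => t; rewrite /= fineK// ge0_fin_numE.
have psi_ge0 t : 0 <= psi t by rewrite -lee_fin -psiK.
have psi_nd : {homo psi : t u / t <= u} by move=> t u tu; rewrite -lee_fin -!psiK psiE_nd.
pose phi t := expR (a * t) * h t.
have phi_cont : continuous phi.
  move=> t; apply: cvgM; last exact: h_cont.
  by apply: continuous_comp; [exact: mulrl_continuous|exact: continuous_expR].
pose n0 := Num.bound a.
have n0a j : (n0 < j)%N -> a < j%:R.
  by move=> jn; apply: lt_trans (archi_boundP (ltW a_gt0)) _; rewrite ltr_nat.
have phi_laplace j : (\int[mu]_(t in `[0%R, +oo[) (expR (- (j%:R * t)) * phi t)%:E =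
   \int[mu]_(t in `[0%R, +oo[) (expR (- ((j%:R - a) * t)) * h t)%:E)%E.
  apply: eq_integral => t _; rewrite mulrA -expRD; congr (expR _ * _)%:E; ring.
have psi_laplace j : (\int[mu]_(t in `[0%R, +oo[) (expR (- (j%:R * t)) * psi t)%:E =
    \int[mu]_(t in `[0%R, +oo[) ((expR (- (j%:R * t)))%:E * psiE t))%E.
  by apply: eq_integral => t _; rewrite psiK EFinM.
have key t : 0 < t -> phi t = psi t.
  have mphi : measurable_fun setT phi by exact: continuous_measurable_fun.
  have mpsi : measurable_fun setT psi by exact: nondecreasing_measurable.
  have phi_ge0 u : 0 <= u -> 0 <= phi u by move=> _; rewrite mulr_ge0 ?expR_ge0.
  have lapE j : (n0 < j)%N ->
      (\int[mu]_(t in `[0%R, +oo[) (expR (- (j%:R * t)) * phi t)%:E =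
       \int[mu]_(t in `[0%R, +oo[) (expR (- (j%:R * t)) * psi t)%:E)%E.
    by move=> /n0a ja; rewrite phi_laplace psi_laplace psiE_laplace.
  have lap_lty j : (n0 < j)%N ->
      (\int[mu]_(t in `[0%R, +oo[) (expR (- (j%:R * t)) * phi t)%:E < +oo)%E.
    by move=> /n0a ja; rewrite phi_laplace h_laplace_lty// subr_gt0.
  exact: (laplace_injective mphi mpsi phi_ge0 (fun u _ => psi_ge0 u)
    (fun u _ => phi_cont u) (fun u w _ => @psi_nd u w) lapE lap_lty).
(* The transform does not determine the value at 0. The constant term gives [phi 0 <= psi 0];
   conversely [psi 0 <= psi t = phi t], which tends to [phi 0]. *)
have key0 : phi 0 = psi 0.
  apply/eqP; rewrite eq_le; apply/andP; split.
    rewrite /phi mulr0 expR0 mul1r (le_trans c00)// -lee_fin -psiK.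
    apply: (@le_trans _ _ (\sum_(0 <= m < 1) \sum_(r <oo) (term m r 0)%:E)%E); last first.
      exact: nneseries_lim_ge.
    rewrite big_nat1.
    apply: (@le_trans _ _ (\sum_(0 <= r < 1) (term 0 r 0)%:E)%E); last first.
      by apply: nneseries_lim_ge => *; rewrite lee_fin.
    by rewrite big_nat1 lee_fin /term n00 expr0 divr1 mulr1.
  have phi0 : phi t @[t --> 0^'+] --> phi 0 by apply: cvg_at_right_filter; exact: phi_cont.
  apply: (cvgr_to_ge phi0); near=> t.
  have t0 : 0 < t by near: t; exact: nbhs_right_gt.
  by rewrite key// psi_nd// ltW.
move=> s0; have -> : (h s)%:E = ((expR (- (a * s)))%:E * psiE s)%E.
  have ->: psiE s = (phi s)%:E.
    by rewrite psiK; move: s0; rewrite le_eqVlt => /predU1P[<-|/key ->//]; rewrite key0.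
  by rewrite -EFinM /phi mulrA -expRD addNr expR0 mul1r.
rewrite -nneseriesZl//; apply: eq_eseriesr => m _; rewrite -nneseriesZl//; last first.
  by move=> *; rewrite lee_fin.
by apply: eq_eseriesr => r _; rewrite -EFinM /term max_r//; congr _%:E; ring.
Unshelve. all: by end_near. Qed.

End power_series_inversion.

Section queue_transition_series.
Context {R : realType}.
Variables (lambda mu : R) (k : nat) (p : R -> state k -> state k -> R).
Hypotheses (lambda_gt0 : 0 < lambda) (mu_gt0 : 0 < mu) (k_gt0 : (0 < k)%N).
Hypothesis p_trans : is_transition_function p.
Hypothesis p_rates : has_rates p (@MEk1_rate R lambda mu k).

Local Notation a := (lambda + k%:R * mu).
Local Notation empty := (empty_state k).

Let q_ge0 i j : 0 <= @MEk1_rate R lambda mu k i j.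
Proof. exact: rate_ge0. Qed.

Let q_nbs i j : j \notin i :: queue_nbs i -> @MEk1_rate R lambda mu k i j = 0.
Proof. exact: rate_nbs. Qed.

Lemma continuous_queue_hit : continuous (fun t => hit p empty t empty).
Proof. exact: (continuous_hit p_trans p_rates q_ge0 (uniq_queue_nbs k_gt0) q_nbs). Qed.

Lemma queue_hit_laplaceE v : 0 < v ->
  (\int[lebesgue_measure]_(t in `[0%R, +oo[) (expR (- (v * t)) * hit p empty t empty)%:E =
   (hit_laplace p empty v empty)%:E)%E.
Proof.
move=> v0; apply/esym.
exact: (hit_laplaceE p_trans p_rates q_ge0 (uniq_queue_nbs k_gt0) q_nbs).
Qed.

Lemma queue_transition_series s : 0 <= s ->
  (\sum_(m <oo) \sum_(r <oo)
     (C0 lambda mu k m.+1 r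
      * (s ^+ (delta0 k m.+1 r).-1 / ((delta0 k m.+1 r).-1)`!%:R)
      * expR (- (a * s)))%:E = (hit p empty s empty)%:E)%E.
Proof.
move: s; apply: power_series_laplace_inversion.
- by rewrite addr_gt0// mulr_gt0// ltr0n.
- by move=> m r; exact: C0_ge0.
- by move=> t; have /andP[] := hit_itv01 p_trans empty t empty.
- exact: continuous_queue_hit.
- by move=> v v0; rewrite queue_hit_laplaceE// -(C0_laplace lambda_gt0 mu_gt0).
- by move=> v v0; rewrite queue_hit_laplaceE// ltry.
- by rewrite /delta0 mul0n addn0.
- rewrite C0_ballot ballotr0// mul0n addn0 subn1 !expr0 !mulr1 /hit maxxx.
  by case: p_trans => _ _ -> _; rewrite eqxx.
Qed.

End queue_transition_series.

(** * The fractional queue *)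

Section random_time.
Context {R : realType} {d} {T : measurableType d} (P : probability T R) (E : countType).
Variables (X : R -> T -> E) (tau : T -> R).
Hypothesis mX : forall (t : R) i, 0 <= t -> measurable [set w | X t w = i].
Hypothesis X_right : forall w (t : R), 0 <= t -> \forall s \near t^'+, X s w = X t w.
Hypothesis mtau : measurable_fun setT tau.
Hypothesis tau_ge0 : forall w, 0 <= tau w.

Let grid_pt n m : R := m.+1%:R / n.+1%:R.

Let grid_pt_ge0 n m : 0 <= grid_pt n m. Proof. exact: divr_ge0. Qed.

(* Times of discrete range tending to tau w along the filter (tau w)^'+, for
   which right-continuity of X is stated: grid n w > tau w strictly. *)
Let grid n w : R := grid_pt n (Num.trunc (n.+1%:R * tau w)).

Let cell n m : set T := [set w | Num.trunc (n.+1%:R * tau w) = m].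

(** Cells become differences of events [tau w < s], the only events of [tau] for which independence
    is assumed. *)
Let cellE n m : cell n m =
  [set w | tau w < m.+1%:R / n.+1%:R] `\` [set w | tau w < m%:R / n.+1%:R].
Proof.
apply/predeqP => w; rewrite /cell /=.
have t0 : 0 <= n.+1%:R * tau w by rewrite mulr_ge0.
rewrite !ltr_pdivlMr// ![tau w * _]mulrC; split => [<-|[h1 /negP h2]].
  by have /andP[h1 h2] := truncn_itv t0; split => //; apply/negP; rewrite -leNgt.
by apply/eqP; rewrite truncn_eq// h1 leNgt h2.
Qed.

Let mcell n m : measurable (cell n m).
Proof. by rewrite cellE; apply: measurableD; apply: measurable_ltr_set. Qed.

Let bigcup_cell n : \bigcup_m cell n m = setT.
Proof. by apply/seteqP; split => // w _; exists (Num.trunc (n.+1%:R * tau w)). Qed.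

Let trivIset_cell n : trivIset setT (cell n).
Proof. by apply/trivIsetP => i j _ _ ij; rewrite -subset0 => w [/= wi wj]; move: ij; rewrite -wi wj eqxx. Qed.

Let grid_near (Q : set R) w : (\forall s \near (tau w)^'+, Q s) ->
  \forall n \near \oo, Q (grid n w).
Proof.
move=> /nbhs_ballP[e /= e0 eQ].
near=> n; have t0 : 0 <= n.+1%:R * tau w by rewrite mulr_ge0.
have /andP[h1 h2] := truncn_itv t0.
have lt : tau w < grid n w by rewrite /grid /grid_pt ltr_pdivlMr// mulrC.
apply: eQ => //; rewrite /ball/= ltr0_norm ?subr_lt0// opprB.
apply: (@le_lt_trans _ _ n.+1%:R^-1).
  rewrite lerBlDl /grid /grid_pt -(natr1 (Num.trunc _)) mulrDl mul1r lerD2r.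
  by rewrite ler_pdivrMr// [leRHS]mulrC.
near: n; exact: (near_infty_natSinv_lt (PosNum e0)).
Unshelve. all: by end_near. Qed.

Let hits n j : set T := [set w | X (grid n w) w = j].

Let hitsE n j : hits n j = \bigcup_m (cell n m `&` [set w | X (grid_pt n m) w = j]).
Proof.
apply/predeqP => w; split => [wj|[m _ [/= wm]]].
  by exists (Num.trunc (n.+1%:R * tau w)).
by rewrite /hits/= /grid wm.
Qed.

Let mhits n j : measurable (hits n j).
Proof.
rewrite hitsE; apply: bigcupT_measurable => m; apply: measurableI => //.
exact: mX.
Qed.

Let hits_cvg j w :
  (\1_(hits n j) w : R) @[n --> \oo] --> (\1_[set w | X (tau w) w = j] w : R).
Proof.
apply: cvg_near_cst; near=> n.
have Xn : X (grid n w) w = X (tau w) w.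
  by near: n; apply: (@grid_near (fun s => X s w = X (tau w) w)); exact: X_right.
rewrite !indicE (_ : (w \in hits n j) = (w \in [set w | X (tau w) w = j]))//.
by apply/idP/idP; rewrite !in_setE /hits/= Xn.
Unshelve. all: by end_near. Qed.

Lemma measurable_random_time j : measurable [set w | X (tau w) w = j].
Proof.
apply/(measurable_indicP R).
apply: (@measurable_fun_cvg _ _ _ _ (fun n => (\1_(hits n j) : T -> R)) \1_[set w | X (tau w) w = j]) => //.
Qed.

Variables (p : R -> E -> E -> R).
Hypothesis p_trans : is_transition_function p.
Hypothesis Xmarkov : markov_property P p X.
Variables i j : E.
Hypothesis hit_cont : continuous (fun t => hit p j t i).
Hypothesis indep : forall t s : R, 0 <= t ->
  (P ([set w | X 0 w = i] `&` [set w | X t w = j] `&` [set w | tau w < s]%R) =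
   P ([set w | X 0 w = i] `&` [set w | X t w = j]) * P [set w | tau w < s]%R)%E.

Let start := [set w | X 0 w = i].

Let hit01 t : 0 <= hit p j t i <= 1. Proof. exact: hit_itv01. Qed.

Let transition t : 0 <= t ->
  (P (start `&` [set w | X t w = j]) = P start * (hit p j t i)%:E)%E.
Proof.
move=> t0; have past0 x : x \in ([::] : seq (R * E)) -> 0 <= x.1 <= 0 by [].
have := Xmarkov i j past0 (lexx 0) t0; rewrite /= subr0 /hit max_r//.
rewrite (_ : [set w | _] = setT) ?setTI//.
by apply/seteqP; split.
Qed.

Let indep_cell t n m : 0 <= t ->
  (P (start `&` [set w | X t w = j] `&` cell n m) =
   P (start `&` [set w | X t w = j]) * P (cell n m))%E.
Proof.
move=> t0; set A := start `&` _; rewrite cellE.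
have mA : measurable A by apply: measurableI; exact: mX.
set b := m.+1%:R / _; set c := m%:R / _.
have cb : [set w | tau w < c] `<=` [set w | tau w < b].
  by move=> w /= /lt_trans; apply; rewrite ltr_pM2r ?invr_gt0// ltr_nat.
have mlt s : measurable [set w | tau w < s] by exact: measurable_ltr_set.
have fin S : measurable S -> (P S < +oo)%E.
  by move=> mS; rewrite (le_lt_trans (probability_le1 _ mS))// ltry.
have finN S : measurable S -> P S \is a fin_num by move=> mS; exact: fin_num_measure.
have mAb : measurable (A `&` [set w | tau w < b]) by exact: measurableI.
rewrite setIDA (measureD mAb (mlt c) (fin _ mAb)) (measureD (mlt b) (mlt c) (fin _ (mlt b))).
have indepA s : (P (A `&` [set w | tau w < s]%R) = P A * P [set w | tau w < s]%R)%E := indep s t0.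
rewrite -(setIA A) (setIidr cb).
transitivity (P A * P [set w | tau w < b]%R - P A * P [set w | tau w < c]%R)%E.
  by congr (_ - _)%E; exact: indepA.
rewrite muleBr//; first exact: finN.
by rewrite fin_num_adde_defl// fin_numN finN.
Qed.

(** On each cell the discretized time is constant, so independence and the transition probability at
    a fixed time apply cell by cell. *)
Let hits_startE n : (P (hits n j `&` start) = P start * \int[P]_w (hit p j (grid n w) i)%:E)%E.
Proof.
have mhc : measurable_fun setT (hit p j ^~ i) := continuous_measurable_fun hit_cont.
have mg : measurable_fun (\bigcup_m cell n m) (fun w => (hit p j (grid n w) i)%:E).
  apply/measurable_fun_bigcup => // m.
  apply: (eq_measurable_fun (cst (hit p j (grid_pt n m) i)%:E)) => //.
  by move=> w; rewrite inE /= => wm; rewrite /grid wm.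
have -> : (\int[P]_w (hit p j (grid n w) i)%:E =
    \sum_(m <oo) (hit p j (grid_pt n m) i)%:E * P (cell n m))%E.
  rewrite -(bigcup_cell n) (ge0_integral_bigcup P (mcell n) mg)//; last first.
    by move=> w _; rewrite lee_fin; case/andP: (hit01 (grid n w)).
  apply: eq_eseriesr => m _; rewrite -integral_cst//; apply: eq_integral => w.
  by rewrite inE /= => wm; rewrite /grid wm.
rewrite hitsE setI_bigcupl measure_semi_bigcup//; last 3 first.
- by move=> m; apply: measurableI; [apply: measurableI|]; rewrite //; exact: mX.
- apply/trivIsetP => m m' _ _ mm'; rewrite -subset0 => w [[[/= wm _] _] [[/= wm' _] _]].
  by move: mm'; rewrite -wm -wm' eqxx.
- by apply: bigcupT_measurable => m; apply: measurableI; [apply: measurableI|]; rewrite //; exact: mX.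
rewrite -(fineK (fin_num_measure P _ (mX i (lexx 0)))) -nneseriesZl; last first.
  by move=> m _; rewrite mule_ge0// lee_fin; case/andP: (hit01 (grid_pt n m)).
apply: eq_eseriesr => m _; rewrite (setIC (cell n m)) -setIA (setIC (cell n m)) setIA (setIC _ start).
rewrite fineK ?fin_num_measure//; last exact: mX.
by rewrite muleA -transition// -indep_cell.
Qed.

(** Both sides of the discretized identity converge: the left one because X is right-continuous and
    discrete, hence eventually constant along the grid, the right one because [hit] is continuous.
    All integrands lie between 0 and 1. *)
Lemma random_time_transition :
  (P ([set w | X (tau w) w = j] `&` [set w | X 0 w = i]) =
   P [set w | X 0 w = i] * \int[P]_w (hit p j (tau w) i)%:E)%E.
Proof.
have mhc : measurable_fun setT (hit p j ^~ i) := continuous_measurable_fun hit_cont.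
have mstart : measurable start by exact: mX.
have int1 : P.-integrable setT (cst 1%E : T -> \bar R).
  apply/integrableP; split => //; rewrite (eq_integral (cst 1%:E)); last by move=> *; rewrite /= normr1.
  by rewrite integral_cst_probability ltry.
have intE S : measurable S -> P S = (\int[P]_w (\1_S w)%:E)%E.
  by move=> mS; rewrite integral_indic// setIT.
have mB j' n : measurable (hits n j' `&` start) by exact: measurableI.
have mtauj : measurable ([set w | X (tau w) w = j] `&` start).
  by apply: measurableI => //; exact: measurable_random_time.
have cvgP : P (hits n j `&` start) @[n --> \oo] --> P ([set w | X (tau w) w = j] `&` start).
  rewrite (intE _ mtauj); under eq_fun do rewrite (intE _ (mB _ _)).
  apply: (@dominated_cvg _ _ _ P _ measurableT _ _ (cst 1%E)) => //.
  - by move=> n; apply/measurable_EFinP; exact: measurable_indic.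
  - move=> w _; apply: cvg_EFin; first exact: nearW.
    rewrite /comp/=; under eq_fun do rewrite indicI.
    rewrite indicI; apply: cvgM; [exact: hits_cvg|exact: cvg_cst].
  - by move=> n w _; rewrite gee0_abs ?lee_fin// indicE; case: (_ \in _).
have cvgI : (\int[P]_w (hit p j (grid n w) i)%:E)%E @[n --> \oo] -->
    (\int[P]_w (hit p j (tau w) i)%:E)%E.
  apply: (@dominated_cvg _ _ _ P _ measurableT _ _ (cst 1%E)) => //.
  - move=> n; rewrite -(bigcup_cell n); apply/measurable_fun_bigcup => // m.
    apply: (eq_measurable_fun (cst (hit p j (grid_pt n m) i)%:E)) => //.
    by move=> w; rewrite inE /= => wm; rewrite /grid wm.
  - move=> w _; apply: cvg_EFin; first exact: nearW.
    have hr : hit p j s i @[s --> (tau w)^'+] --> hit p j (tau w) i.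
      by apply: cvg_at_right_filter; exact: hit_cont.
    by move=> Q /hr /(@grid_near (fun s => Q (hit p j s i)) w).
  - by move=> n w _; rewrite gee0_abs lee_fin; case/andP: (hit01 (grid n w)).
have fin : P start \is a fin_num by exact: fin_num_measure.
have := cvgeZl fin cvgI; under eq_fun do rewrite -hits_startE.
exact: cvg_unique.
Qed.

End random_time.

Section histories.
Context {R : realType} {d} {T : measurableType d}.

(** The measurability of the inverse process is instantiated on the same space with the smaller
    sigma-algebra generated by [sigma]. *)
Lemma real_history_inverse_process (sigma : R -> T -> R) (t s : R) :
  (forall w (u v : R), 0 <= u -> u <= v -> sigma u w <= sigma v w) ->
  real_history sigma [set w | inverse_process sigma t w < s].
Proof.
move=> sigma_nd.
set G := [set A | exists (t : R) (B : set R), [/\ 0 <= t, measurable B & A = sigma t @^-1` B]].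
pose S := g_sigma_algebraType G.
have msigma u : 0 <= u -> measurable_fun setT (sigma u : S -> R).
  move=> u0 _ B mB; rewrite setTI; apply: sub_sigma_algebra.
  by exists u, B.
have mL : measurable_fun setT (inverse_process sigma t : S -> R).
  exact: (measurableT_comp (@measurable_inverse_process R _ S sigma sigma_nd msigma)
    (measurable_pair1 (t : measurableTypeR R))).
exact: (measurable_ltr_set mL (measurable_cst s)).
Qed.

Lemma discrete_history_setI (E : Type) (X : R -> T -> E) (s t : R) i j : 0 <= s -> 0 <= t ->
  discrete_history X ([set w | X s w = i] `&` [set w | X t w = j]).
Proof.
move=> s0 t0.
set G := [set A | exists (t : R) i, 0 <= t /\ A = [set w | X t w = i]].
apply: (@measurableI _ (g_sigma_algebraType G)); apply: sub_sigma_algebra.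
  by exists s, i.
by exists t, j.
Qed.

End histories.

Lemma measure_ae_eq {d} {T : measurableType d} {R : realType} (P : {measure set T -> \bar R})
    (A B : set T) : measurable A -> measurable B ->
  (\forall w \ae P, A w <-> B w) -> P A = P B.
Proof.
move=> mA mB AB; rewrite -(setIT A) -(setIT B) -!(@integral_indic _ _ R)//.
have mI (C : set T) : measurable C -> measurable_fun setT (fun w : T => (\1_C w : R)%:E).
  by move=> mC; apply/measurable_EFinP; exact: measurable_indic.
apply: (ge0_ae_eq_integral measurableT (mI _ mA) (mI _ mB)).
- by move=> w _; rewrite lee_fin.
- by move=> w _; rewrite lee_fin.
apply: filterS AB => w AB _ /=; rewrite !indicE.
by rewrite (_ : (w \in A) = (w \in B))//; apply/idP/idP; rewrite !inE => /AB.
Qed.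

(** * Empty-state probability of the fractional queue *)

Section fractional_queue_law.
Context {R : realType} {d} {T : measurableType d} (P : probability T R).
Variables (lambda mu nu : R) (k : nat) (Qnu : R -> T -> state k).
Hypotheses (lambda_gt0 : 0 < lambda) (mu_gt0 : 0 < mu) (k_gt0 : (0 < k)%N) (nu_gt0 : 0 < nu).
Variables (Q : R -> T -> state k) (sigma : R -> T -> R) (p : R -> state k -> state k -> R).
Hypothesis mQ : forall (t : R) i, 0 <= t -> measurable [set w | Q t w = i].
Hypothesis Q_right : forall w (t : R), 0 <= t -> \forall s \near t^'+, Q s w = Q t w.
Hypothesis p_trans : is_transition_function p.
Hypothesis p_rates : has_rates p (@MEk1_rate R lambda mu k).
Hypothesis Qmarkov : markov_property P p Q.
Hypothesis sigmaP : is_stable_subordinator P nu sigma.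
Hypothesis indep : independent_sigma_algebras P (discrete_history Q) (real_history sigma).
Hypothesis QnuE : forall (t : R) w, 0 <= t -> Qnu t w = Q (inverse_process sigma t w) w.
Hypothesis Qnu0 : (0 < P [set w | Qnu 0%R w = empty_state k])%E.

Local Notation empty := (empty_state k).
Local Notation L := (inverse_process sigma).
Local Notation a := (lambda + k%:R * mu).
Local Notation p00 := (fun t => hit p empty t empty).

Let mQL t : measurable [set w | Q (L t w) w = empty].
Proof.
apply: (measurable_random_time mQ Q_right (inverse_subordinator_measurable1 sigmaP t)).
exact: inverse_subordinator_ge0 sigmaP t.
Qed.

Let ae_start : \forall w \ae P, Q (L 0 w) w = empty <-> Q 0 w = empty.
Proof. by apply: filterS (ae_inverse_process0 nu_gt0 sigmaP) => w ->. Qed.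

Let p00_ge0 t : 0 <= p00 t.
Proof. by have /andP[] := hit_itv01 p_trans empty t empty. Qed.

Let mp00 : measurable_fun setT (fun t => (p00 t)%:E).
Proof.
apply/measurable_EFinP; apply: continuous_measurable_fun.
exact: (continuous_queue_hit lambda_gt0 mu_gt0 k_gt0 p_trans p_rates).
Qed.

(** The conditioning event concerns Q at L_0 and is replaced, up to a null set, by the event that Q
    starts empty; its positive probability then cancels in the quotient. *)
Lemma p0_expectation t : 0 <= t ->
  (p0 P Qnu t)%:E = (\int[P]_w (p00 (L t w))%:E)%E.
Proof.
move=> t0; have mstart : measurable [set w | Q 0 w = empty] by exact: mQ.
have startE : [set w | Qnu 0 w = empty] = [set w | Q (L 0 w) w = empty].
  by apply/seteqP; split => w /=; rewrite QnuE.
have tE : [set w | Qnu t w = empty] = [set w | Q (L t w) w = empty].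
  by apply/seteqP; split => w /=; rewrite QnuE.
have PstartE : P [set w | Q (L 0 w) w = empty] = P [set w | Q 0 w = empty].
  exact: measure_ae_eq.
have Ps0 : (0 < P [set w | Q 0 w = empty])%E by rewrite -PstartE -startE.
have Psfin : P [set w | Q 0 w = empty] \is a fin_num by exact: fin_num_measure.
rewrite /p0 /cond_prob tE startE PstartE.
have -> : P ([set w | Q (L t w) w = empty] `&` [set w | Q (L 0 w) w = empty]) =
    P ([set w | Q (L t w) w = empty] `&` [set w | Q 0 w = empty]).
  apply: measure_ae_eq; try exact: measurableI.
  by apply: filterS ae_start => w /=; tauto.
have indepL (u s : R) : 0 <= u ->
  (P ([set w | Q 0 w = empty] `&` [set w | Q u w = empty] `&` [set w | L t w < s]%R) =
   P ([set w | Q 0 w = empty] `&` [set w | Q u w = empty]) * P [set w | L t w < s]%R)%E.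
  move=> u0; apply: indep; first exact: discrete_history_setI.
  by apply: real_history_inverse_process; case: sigmaP => _ _ [sigma_nd _] _ _.
rewrite (random_time_transition mQ Q_right (inverse_subordinator_measurable1 sigmaP t)
  (inverse_subordinator_ge0 sigmaP t) p_trans Qmarkov
  (continuous_queue_hit lambda_gt0 mu_gt0 k_gt0 p_trans p_rates) indepL).
have int01 : (0 <= \int[P]_w (p00 (L t w))%:E <= 1)%E.
  apply/andP; split; first by apply: integral_ge0 => w _; rewrite lee_fin p00_ge0.
  rewrite -(integral_cst_probability P 1); apply: ge0_le_integral => //.
  - by move=> w _; rewrite lee_fin p00_ge0.
  - exact: (measurableT_comp mp00 (inverse_subordinator_measurable1 sigmaP t)).
  - by move=> w _; rewrite lee_fin; case/andP: (hit_itv01 p_trans empty (L t w) empty).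
have Ifin : (\int[P]_w (p00 (L t w))%:E)%E \is a fin_num.
  by case/andP: int01 => i0 i1; rewrite ge0_fin_numE// (le_lt_trans i1)// ltry.
rewrite fineM// mulrAC divff ?mul1r ?fineK//.
by rewrite lt0r_neq0// fine_gt0// Ps0 ltey_eq Psfin.
Qed.

Let term m r (x : R) := C0 lambda mu k m.+1 r
  * (x ^+ (delta0 k m.+1 r).-1 / ((delta0 k m.+1 r).-1)`!%:R) * expR (- (a * x)).

Let term_ge0 m r t w : (0 <= (term m r (L t w))%:E)%E.
Proof.
have L0 := inverse_subordinator_ge0 sigmaP t w.
rewrite lee_fin /term mulr_ge0 ?expR_ge0// mulr_ge0//; first exact: C0_ge0.
by rewrite divr_ge0// exprn_ge0.
Qed.

Let mterm m r t : measurable_fun setT (fun w => (term m r (L t w))%:E).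
Proof.
have mL := inverse_subordinator_measurable1 sigmaP t.
apply/measurable_EFinP; apply: measurable_funM.
  by apply: measurable_funM => //; apply: measurable_funM => //; exact: measurable_funX.
exact: (measurableT_comp (measurable_expRN a) mL).
Qed.

Lemma p0_term t m r : 0 <= t ->
  (C0 lambda mu k m.+1 r * t `^ (gamma0 nu k m.+1 r - 1)
    * mittag_leffler nu (gamma0 nu k m.+1 r) (delta0 k m.+1 r)%:R (- (a * t `^ nu)))%:E
  = (\int[P]_w (term m r (L t w))%:E)%E.
Proof.
move=> t0; have mL := inverse_subordinator_measurable1 sigmaP t.
have L0 := inverse_subordinator_ge0 sigmaP t.
have a_ge0 : 0 <= a by rewrite ltW// addr_gt0// mulr_gt0// ltr0n.
pose N := (delta0 k m.+1 r).-1; have dE : delta0 k m.+1 r = N.+1 by [].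
have gE : gamma0 nu k m.+1 r = nu * N%:R + 1 by rewrite /gamma0 dE -natr1 addrK.
rewrite gE addrK dE.
have N0 : N`!%:R != 0 :> R by rewrite pnatr_eq0 -lt0n fact_gt0.
have c0 : 0 <= C0 lambda mu k m.+1 r / N`!%:R by rewrite divr_ge0//; exact: C0_ge0.
transitivity (\int[P]_w ((C0 lambda mu k m.+1 r / N`!%:R)%:E *
    (L t w ^+ N * expR (- (a * L t w)))%:E))%E; last first.
  by apply: eq_integral => w _; rewrite -EFinM /term; congr _%:E; rewrite -/N; ring.
rewrite ge0_integralZl_EFin//.
- rewrite (inverse_subordinator_mittag_leffler nu_gt0 sigmaP)// -EFinM; congr _%:E.
  by move: (mittag_leffler _ _ _ _) (t `^ _) => x y; field.
- by move=> w _; rewrite lee_fin mulr_ge0 ?expR_ge0 ?exprn_ge0.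
- apply/measurable_EFinP; apply: measurable_funM; first exact: measurable_funX.
  exact: (measurableT_comp (measurable_expRN a) mL).
Qed.

Lemma p0_series t : 0 <= t ->
  double_series_sum
    (fun m r => C0 lambda mu k m r * t `^ (gamma0 nu k m r - 1)
      * mittag_leffler nu (gamma0 nu k m r) (delta0 k m r)%:R (- (a * t `^ nu)))
    (p0 P Qnu t).
Proof.
move=> t0; apply: double_series_sum_nneseries.
  (* The sign is not visible on the alternating Mittag-Leffler series; it comes from its form as an
     expectation. *)
  by move=> m r; rewrite -lee_fin p0_term//; apply: integral_ge0.
rewrite p0_expectation//.
have mfs m : measurable_fun setT (fun w => \sum_(r <oo) (term m r (L t w))%:E)%E.
  by apply: ge0_emeasurable_sum => // r w _ _.
have fs0 m w : (0 <= \sum_(r <oo) (term m r (L t w))%:E)%E by exact: nneseries_ge0.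
have -> : (\int[P]_w (p00 (L t w))%:E =
    \int[P]_w (\sum_(m <oo) \sum_(r <oo) (term m r (L t w))%:E))%E.
  apply: eq_integral => w _; rewrite -(queue_transition_series lambda_gt0 mu_gt0)//.
  exact: inverse_subordinator_ge0 sigmaP t w.
rewrite integral_nneseries//; apply: eq_eseriesr => m _.
by rewrite integral_nneseries//; apply: eq_eseriesr => r _; rewrite p0_term.
Qed.

(** The factor 1/v normalizes the exponential density of rate v; L turns that time into one of rate
    v^nu, whose density brings the factor v^nu. *)
Lemma laplace_p0 v : 0 < v ->
  laplace (p0 P Qnu) v = v `^ (nu - 1) * hit_laplace p empty (v `^ nu) empty.
Proof.
move=> v0; have vnu0 : 0 < v `^ nu by rewrite powR_gt0.
have p00_ge0E s : (0 <= (p00 s)%:E)%E by rewrite lee_fin.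
have mE := measurable_expectation_inverse sigmaP mp00 p00_ge0E.
have E0 s : (0 <= \int[P]_w (p00 (L s w))%:E)%E by apply: integral_ge0.
rewrite /laplace /Rintegral.
transitivity (fine (\int[lebesgue_measure]_(s in `[0%R, +oo[)
    ((expR (- (v * s)))%:E * \int[P]_w (p00 (L s w))%:E))%E).
  congr fine; apply: eq_integral => s; rewrite inE/= in_itv/= andbT => s0.
  by rewrite EFinM p0_expectation.
rewrite (laplace_exponential_law v0 mE E0).
rewrite (exponential_time_inverse sigmaP v0 vnu0 mp00 p00_ge0E).
have := laplace_exponential_law vnu0 mp00 p00_ge0E.
under eq_integral do rewrite -EFinM.
rewrite (queue_hit_laplaceE lambda_gt0 mu_gt0 k_gt0 p_trans p_rates vnu0) => hE.
have -> : (\int[exponential_law vnu0]_s (p00 s)%:E =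
    (v `^ nu * hit_laplace p empty (v `^ nu) empty)%:E)%E.
  by rewrite EFinM hE muleA -EFinM divff ?mul1e// lt0r_neq0.
rewrite -EFinM/= mulrA -(mulr_powRB1 (ltW v0) nu_gt0) mulKf//.
exact: lt0r_neq0.
Qed.

Lemma laplace_p0_series v : 0 < v ->
  double_series_sum
    (fun m r => C0 lambda mu k m r
      * (v `^ (nu * (delta0 k m r)%:R - gamma0 nu k m r) / (a + v `^ nu) ^+ delta0 k m r))
    (laplace (p0 P Qnu) v).
Proof.
move=> v0; have vnu0 : 0 < v `^ nu by rewrite powR_gt0.
have av0 : 0 < a + v `^ nu by rewrite !addr_gt0// mulr_gt0// ltr0n.
apply: double_series_sum_nneseries => [m r|].
  apply: mulr_ge0; first exact: C0_ge0.
  apply: divr_ge0; first exact: powR_ge0.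
  by rewrite exprn_ge0// ltW.
have c0 m r : (0 <= (C0 lambda mu k m.+1 r / (a + v `^ nu) ^+ delta0 k m.+1 r)%:E)%E.
  rewrite lee_fin; apply: divr_ge0; first exact: C0_ge0.
  by rewrite exprn_ge0// ltW.
rewrite laplace_p0// EFinM -(C0_laplace lambda_gt0 mu_gt0 k_gt0 p_trans p_rates vnu0).
rewrite -nneseriesZl; last by move=> m _; exact: nneseries_ge0.
apply: eq_eseriesr => m _; rewrite -nneseriesZl//; apply: eq_eseriesr => r _.
(* The exponent does not depend on m and r, so the power of v factors out of the double sum. *)
rewrite -EFinM (_ : nu * _ - _ = nu - 1); last by rewrite /gamma0; ring.
by rewrite mulrCA.
Qed.

End fractional_queue_law.

Theorem theorem5p1 (R : realType) (d : measure_display) (T : measurableType d)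
    (P : probability T R) (lambda mu nu : R) (k : nat)
    (Qnu : R -> T -> state k)
    (lambda_gt0 : 0 < lambda) (mu_gt0 : 0 < mu) (k_ge1 : (1 <= k)%N)
    (nu_gt0 : 0 < nu) (nu_lt1 : nu < 1)
    (HQ : is_fractional_MEk1 P lambda mu nu Qnu)
    (Qnu0 : (0 < P [set w | Qnu 0%R w = empty_state k])%E) :
  (forall t : R, 0 <= t ->
    double_series_sum
      (fun m r => C0 lambda mu k m r * t `^ (gamma0 nu k m r - 1)
        * mittag_leffler nu (gamma0 nu k m r) (delta0 k m r)%:R
            (- ((lambda + k%:R * mu) * t `^ nu)))
      (p0 P Qnu t)) /\
  (forall v : R, 0 < v ->
    double_series_sum
      (fun m r => C0 lambda mu k m r
        * (v `^ (nu * (delta0 k m r)%:R - gamma0 nu k m r)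
           / (lambda + k%:R * mu + v `^ nu) ^+ delta0 k m r))
      (laplace (p0 P Qnu) v)).
Proof.
have [Q [sigma [[mQ Q_right [p [p_trans p_rates Qmarkov]]] sigmaP indep QnuE]]] := HQ.
split=> [t t0|v v0].
- exact: (p0_series lambda_gt0 mu_gt0 k_ge1 nu_gt0 mQ Q_right p_trans p_rates
    Qmarkov sigmaP indep QnuE Qnu0).
- exact: (laplace_p0_series lambda_gt0 mu_gt0 k_ge1 nu_gt0 mQ Q_right p_trans p_rates
    Qmarkov sigmaP indep QnuE Qnu0).
Qed.
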